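(* Let $d\ge 2$ be an integer and let $\{X_{\mathbf n};\ \mathbf n\in\mathbb N^d\}$ be a negatively associated field of identically distributed random variables satisfying $$\mathbb E X_{\mathbf 1}=0\quad\text{and}\quad \mathbb E\Big[X_{\mathbf 1}^2\,\log^{d-1}(|X_{\mathbf 1}|)\big/\log\log(|X_{\mathbf 1}|)\Big]<\infty .$$ Then $$\limsup_{\mathbf n\to\infty}\frac{|S_{\mathbf n}|}{(2d|\mathbf n|\log\log|\mathbf n|)^{1/2}}\le(\mathbb E X_{\mathbf 1}^2)^{1/2}\quad\text{a.s.}$$
   Context: A finite family $\{X_i;1\le i\le n\}$ of random variables is negatively associated if for every pair of disjoint subsets $A,B\subset\{1,\dots,n\}$, $\operatorname{Cov}(f(X_i;i\in A),g(X_j;j\in B))\le 0$ whenever $f,g$ are coordinatewise non-decreasing and the covariance exists; an infinite family is negatively associated if every finite subfamily is. For $\mathbf n=(n_1,\dots,n_d)\in\mathbb N^d$, $|\mathbf n|=n_1\cdots n_d$; $\mathbf k\le\mathbf n$ means $k_i\le n_i$ for all $i$; $\mathbf 1=(1,\dots,1)$; $S_{\mathbf n}=\sum_{\mathbf k\le\mathbf n}X_{\mathbf k}$; $\mathbf n\to\infty$ means $n_1\to\infty,\dots,n_d\to\infty$. Throughout, $\log x=\ln(x\vee e)$. *)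

(* Defs.v *)
From HB Require Import structures.
From mathcomp Require Import all_boot all_order all_algebra.
From mathcomp Require Import all_classical all_reals all_analysis.
Set Implicit Arguments. Unset Strict Implicit. Unset Printing Implicit Defensive.
Import Order.TTheory GRing.Theory Num.Theory.
Import numFieldNormedType.Exports.
Local Open Scope classical_set_scope.
Local Open Scope ring_scope.

Definition mindex (dim : nat) := {ffun 'I_dim -> nat}.

Definition mpos (dim : nat) (n : mindex dim) : bool := [forall i, (0 < n i)%N].

Definition mone (dim : nat) : mindex dim := [ffun => 1%N].

Definition msize (dim : nat) (n : mindex dim) : nat := (\prod_(i < dim) n i)%N.

Definition Log (R : realType) (x : R) : R := ln (Num.max x (expR 1)).

(* S_n = sum_{1 <= k <= n} X_k ; k_i ranges over {1,..,n_i}, encoded as j.+1 with j : 'I_(n i) *)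
Definition Ssum (dim : nat) (T : Type) (R : realType) (X : mindex dim -> T -> R)
  (n : mindex dim) (w : T) : R :=
  \sum_(k : {dffun forall i : 'I_dim, 'I_(n i)}) X [ffun i => (k i).+1] w.

(* Negative association of the family {X_n ; n in J}: for all disjoint finite
   subsets A, B of J (given as duplicate-free tuples) and all coordinatewise
   nondecreasing f, g, Cov(f(X_A), g(X_B)) <= 0 whenever this covariance exists
   (i.e. f(X_A), g(X_B) and their product are integrable). *)
Definition neg_assoc (d : measure_display) (T : measurableType d) (R : realType)
  (P : probability T R) (I : eqType) (J : set I) (X : I -> T -> R) : Prop :=
  forall (m p : nat) (A : m.-tuple I) (B : p.-tuple I)
    (f : {ffun 'I_m -> R} -> R) (g : {ffun 'I_p -> R} -> R),
    uniq A -> uniq B ->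
    (forall a, a \in A -> J a) -> (forall b, b \in B -> J b) ->
    (forall a, a \in A -> a \notin B) ->
    (forall x y : {ffun 'I_m -> R}, (forall j, x j <= y j) -> f x <= f y) ->
    (forall x y : {ffun 'I_p -> R}, (forall j, x j <= y j) -> g x <= g y) ->
    let F := fun w => f [ffun j => X (tnth A j) w] in
    let G := fun w => g [ffun j => X (tnth B j) w] in
    P.-integrable setT (EFin \o F) ->
    P.-integrable setT (EFin \o G) ->
    P.-integrable setT (EFin \o (F \* G)) ->
    ('E_P[F \* G] - 'E_P[F] * 'E_P[G] <= 0)%E.

Definition mlimsup (R : realType) (dim : nat) (a : mindex dim -> R) : \bar R :=
  ereal_inf [set ereal_sup [set (a n)%:E | n in [set n : mindex dim | forall i, (N <= n i)%N]]
            | N in [set: nat]].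

(* Main.v *)
(* Write m = sum_i floor (log_2 n_i) for the level of the index n, so that
   2^m <= |n| < 2^(m + d), and l = ln m, which is log log |n| up to o(1). There
   are about m^(d-1) dyadic cells at level m, and it suffices, by Borel-Cantelli
   and for X and -X separately, to bound probabilities by K m^(-1-rho).

   By negative association, exponential moments of sums of X_i truncated from
   above are at most those of independent copies, which gives Chernoff bounds.
   Truncation from above only makes the mean smaller, so no centering is needed.
   Since d >= 2, the moment condition gives P(X > b) = O(b^-2 (log b)^(-1/2)),
   so that truncation at a small multiple of sqrt(2^m l) costs only O(1) in the
   exponent; the full moment condition is what makes exceedances of that level
   among all indices of level at most m summable in m.

   No maximal inequality for fields is used. Keeping q + 1 binary digits of every
   coordinate rounds n down to a point p of a grid with a bounded number of
   points per dyadic cell, where the sharp bound m^(-d(1+rho)) is available.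
   Keeping about 2 log_2 m digits gives a grid point r with p <= r <= n. The
   increment of S from p to r is small because its variance is, and there are
   only polynomially many r. Between r and n the number of terms is
   O(2^m / m^2): terms are cut at c = sqrt(2^m) / m, the parts below c satisfy an
   exponential bound strong enough for a union over all n of level m, and the
   positive parts of X_i - c are summed over the whole cell of r. *)
Require Import Defs.
From HB Require Import structures.
From mathcomp Require Import all_boot all_order all_algebra.
From mathcomp Require Import all_classical all_reals all_analysis measurable_realfun.
From mathcomp Require Import ring lra zify.
Set Implicit Arguments. Unset Strict Implicit. Unset Printing Implicit Defensive.
Import Order.TTheory GRing.Theory Num.Theory.
Import numFieldNormedType.Exports.
Local Open Scope classical_set_scope.
Local Open Scope ring_scope.

(** * Chernoff bounds under negative association *)

Lemma measurable_ge_preimage d (T : measurableType d) (R : realType)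
  (f : T -> R) (x : R) :
  measurable_fun setT f -> measurable [set w | x <= f w].
Proof.
move=> mf; rewrite (_ : [set w | _] = setT `&` f @^-1` `[x, +oo[%classic).
  by apply: mf.
by apply/seteqP; split => w /=; rewrite in_itv /= andbT => // -[].
Qed.

Section chernoff.
Context d (T : measurableType d) (R : realType) (P : probability T R).
Variables (dim : nat) (X : mindex dim -> T -> R).
Hypothesis mX : forall n, mpos n -> measurable_fun setT (X n).
Hypothesis naX : neg_assoc P (fun n => mpos n) X.
Hypothesis idX : forall n, mpos n -> forall B : set R, measurable B ->
  P (X n @^-1` B) = P (X (mone dim) @^-1` B).

Lemma mpos_mone : mpos (mone dim).
Proof. by apply/forallP => i; rewrite ffunE. Qed.

Lemma measurable_fun_sum (f : R -> R) (s : seq (mindex dim)) :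
  measurable_fun setT f -> all (@mpos dim) s ->
  measurable_fun setT (fun w => \sum_(i <- s) f (X i w)).
Proof.
move=> mf ps; rewrite (_ : (fun w => _) = (fun w => \sum_(i <- s)
   (if mpos i then f (X i w) else 0))); last first.
  apply/funext => w; rewrite big_seq [RHS]big_seq; apply: eq_bigr => i si.
  by rewrite (allP ps i si).
apply: measurable_sum => i; case: (boolP (mpos i)) => pi //.
exact: measurableT_comp mf (mX pi).
Qed.

Lemma integral_identically_distributed (h : R -> R) n : measurable_fun setT h ->
  (forall x, 0 <= h x) -> mpos n ->
  (\int[P]_w (h (X n w))%:E = \int[P]_w (h (X (mone dim) w))%:E)%E.
Proof.
move=> mh h0 pn.
have H k : mpos k -> (\int[P]_w (h (X k w))%:E =
    \int[pushforward P (X k)]_x (h x)%:E)%E.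
  move=> pk; rewrite (ge0_integral_pushforward (mX pk)) //.
  - exact/measurable_EFinP.
  - by move=> y _; rewrite lee_fin.
rewrite !H //; last exact: mpos_mone.
apply: eq_measure_integral; [exact: (mX mpos_mone)|exact: (mX pn)|].
by move=> m1 m2 A mA _; exact: idX.
Qed.

(** Induction on [s]: the head factor and the product of the others are nondecreasing functions of
    disjoint subfamilies, so their covariance is at most 0. Nonnegativity of [h] makes the product
    nondecreasing; the bound [C] makes the covariance exist. *)
Lemma integral_prod_neg_assoc (h : R -> R) (C e : R) (s : seq (mindex dim)) :
  {homo h : x y / x <= y} -> (forall x, 0 <= h x <= C) -> uniq s ->
  all (@mpos dim) s ->
  (\int[P]_w (h (X (mone dim) w))%:E <= e%:E)%E ->
  (\int[P]_w (\prod_(i <- s) h (X i w))%:E <= (e ^+ size s)%:E)%E.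
Proof.
move=> hnd hC us ps he.
have h0 x : 0 <= h x by case/andP: (hC x).
have mh : measurable_fun setT h.
  by apply: nondecreasing_measurable => // x y _ _; exact: hnd.
have e0 : 0 <= e.
  by rewrite -lee_fin (le_trans _ he) // integral_ge0 // => w _; rewrite lee_fin.
have C0 : 0 <= C by case/andP: (hC 0) => /le_trans; apply.
have mhX i : mpos i -> measurable_fun setT (fun w => h (X i w)).
  by move=> pi; exact: measurableT_comp mh (mX pi).
have bprod (r : seq (mindex dim)) w : 0 <= \prod_(i <- r) h (X i w) <= C ^+ size r.
  elim: r => [|i r /andP[IH1 IH2]]; first by rewrite big_nil expr0 ler01 lexx.
  rewrite big_cons mulr_ge0 //= exprS ler_pM //.
  by case/andP: (hC (X i w)).
have iprod r : all (@mpos dim) r ->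
    P.-integrable setT (EFin \o (fun w => \prod_(i <- r) h (X i w))).
  move=> /allP pr; apply: measurable_bounded_integrable => //.
  - by rewrite (le_lt_trans (probability_le1 _ _)) ?ltry.
  - by apply: measurable_prod => i /pr/mhX.
  - exists (C ^+ size r); split; first exact: num_real.
    move=> M CM w _ /=; have /andP[b1 b2] := bprod r w.
    by rewrite ger0_norm // (le_trans b2) // ltW.
elim: s us ps => [|a s IH] /=.
  move=> _ _; under eq_integral do rewrite big_nil.
  by rewrite integral_cst //= probability_setT mule1 expr0.
move=> /andP[nas us] /andP[pa ps].
have := @naX 1 (size s) [tuple of [:: a]] (in_tuple s)
  (fun x => h (x ord0)) (fun x => \prod_(j < size s) h (x j)).
have -> : (fun w => \prod_(j < size s) h ([ffun j => X (tnth (in_tuple s) j) w] j))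
   = (fun w => \prod_(i <- s) h (X i w)).
  apply/funext => w; rewrite (big_tnth _ _ s).
  by apply: eq_bigr => j _; rewrite ffunE.
have -> : (fun w => h ([ffun j => X (tnth [tuple of [:: a]] j) w] ord0))
   = (fun w => h (X a w)).
  by apply/funext => w; rewrite ffunE tnth0.
have ia : P.-integrable setT (EFin \o (fun w => h (X a w))).
  rewrite (_ : (fun w => _) = (fun w => \prod_(i <- [:: a]) h (X i w))).
    by apply: iprod; rewrite /= pa.
  by apply/funext => w; rewrite big_seq1.
have ias : P.-integrable setT
    (EFin \o ((fun w => h (X a w)) \* (fun w => \prod_(i <- s) h (X i w)))).
  rewrite (_ : (_ \* _) = (fun w => \prod_(i <- a :: s) h (X i w))).
    by apply: iprod; rewrite /= pa.
  by apply/funext => w; rewrite big_cons.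
move=> /(_ isT us); rewrite /=.
have H1 : forall a0 : mindex dim, a0 \in [tuple of [:: a]] -> mpos a0.
  by move=> b; rewrite inE => /eqP ->.
have H2 : forall a0 : mindex dim, a0 \in in_tuple s -> mpos a0.
  by move=> b bs; move/allP: ps; apply.
have H3 : forall a0 : mindex dim, a0 \in [tuple of [:: a]] -> a0 \notin in_tuple s.
  by move=> b; rewrite inE => /eqP ->.
have H4 : forall x y : {ffun 'I_1 -> R}, (forall j, x j <= y j) ->
   h (x ord0) <= h (y ord0).
  by move=> x y xy; apply: hnd.
have H5 : forall x y : {ffun 'I_(size s) -> R}, (forall j, x j <= y j) ->
   \prod_(j < size s) h (x j) <= \prod_(j < size s) h (y j).
  by move=> x y xy; apply: ler_prod => i _; rewrite h0 hnd.
move=> /(_ H1 H2 H3 H4 H5 ia (iprod s ps) ias).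
rewrite expectation.unlock sube_le0 => H.
have -> : (\int[P]_w (\prod_(i <- a :: s) h (X i w))%:E =
   \int[P]_w (((fun w => h (X a w)) \* (fun w => \prod_(i <- s) h (X i w))) w)%:E)%E.
  by apply: eq_integral => w _; rewrite big_cons.
apply: (le_trans H); rewrite exprS EFinM; apply: lee_pmul.
- by apply: integral_ge0 => w _; rewrite lee_fin.
- by apply: integral_ge0 => w _; rewrite lee_fin; case/andP: (bprod s w).
- by rewrite integral_identically_distributed.
- exact: IH.
Qed.

(** Markov's inequality for the exponential of the sum. A bound on [g] from above suffices, because
    it already bounds [expR \o g]; the Chernoff parameter is part of [g]. *)
Lemma neg_assoc_chernoff (g : R -> R) (M v x : R) (s : seq (mindex dim)) :
  {homo g : x y / x <= y} -> (forall x, g x <= M) -> uniq s ->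
  all (@mpos dim) s ->
  (\int[P]_w (expR (g (X (mone dim) w)))%:E <= (expR v)%:E)%E ->
  (P [set w | (x <= \sum_(i <- s) g (X i w))%R] <=
     (expR (- x + (size s)%:R * v))%:E)%E.
Proof.
move=> gnd gM us ps hv.
have mg : measurable_fun setT g.
  by apply: nondecreasing_measurable => // a b _ _; exact: gnd.
have := @integral_prod_neg_assoc (expR \o g) (expR M) (expR v) s.
move=> /(_ _ _ us ps hv) H.
have {}H : (\int[P]_w (expR (\sum_(i <- s) g (X i w)))%:E <= (expR v ^+ size s)%:E)%E.
  under eq_integral do rewrite expR_sum.
  apply: H; first by move=> a b ab /=; rewrite ler_expR gnd.
  by move=> a /=; rewrite expR_ge0 ler_expR gM.
have mS := measurable_fun_sum mg ps.
have mA : measurable [set w | x <= \sum_(i <- s) g (X i w)].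
  exact: measurable_ge_preimage.
set A := [set w | _].
have HA : ((expR x)%:E * P A <= (expR v ^+ size s)%:E)%E.
  apply: le_trans H; have -> : P A = (\int[P]_w (\1_A w)%:E)%E by rewrite
      (integral_indic P measurableT mA) setIT.
  rewrite -(ge0_integralZl P measurableT); last 3 first.
  - by apply/measurable_EFinP.
  - by move=> w _; rewrite lee_fin.
  - by rewrite lee_fin expR_ge0.
  apply: (@ge0_le_integral _ _ _ P _ measurableT).
  - by move=> w _; rewrite -EFinM lee_fin mulr_ge0 // expR_ge0.
  - by apply/measurable_EFinP; exact: measurable_funM.
  - apply/measurable_EFinP; exact: (measurableT_comp (@measurable_expR R) mS).
  - move=> w _; rewrite -EFinM lee_fin indicE; case: (boolP (w \in A)) => wA.
      by rewrite mulr1 ler_expR; move: wA; rewrite inE.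
    by rewrite mulr0 expR_ge0.
rewrite expRD expRN expRM_natl mulrC EFinM.
by rewrite lee_pdivlMr ?expR_gt0 // muleC.
Qed.
End chernoff.

(** * Dyadic levels and rounding of multi-indices *)

Section binary_levels.
Local Open Scope nat_scope.

(** Keeps the [q.+1] leading binary digits of [n] and zeroes the others. If [n] has at most [q.+1]
    digits, the truncated subtraction gives 0 and [n] is unchanged. *)
Definition dround (q n : nat) : nat :=
  n %/ 2 ^ (trunc_log 2 n - q) * 2 ^ (trunc_log 2 n - q).

(** For positive [n], the largest integer with as many binary digits as [n] and the same leading
    digits. *)
Definition dceil (q n : nat) : nat := dround q n + (2 ^ (trunc_log 2 n - q)).-1.

Lemma dround_le q n : dround q n <= n.
Proof. exact: leq_divM. Qed.

Lemma dceil_ge q n : n <= dceil q n.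
Proof.
rewrite {1}(divn_eq n (2 ^ (trunc_log 2 n - q))) leq_add2l.
by rewrite -ltnS prednK ?expn_gt0 // ltn_mod expn_gt0.
Qed.

Lemma expn_trunc_log_le_dround q n : 0 < n -> 2 ^ trunc_log 2 n <= dround q n.
Proof.
move=> n0; rewrite /dround; set t := trunc_log 2 n.
have := trunc_logP (isT : 1 < 2) n0; rewrite -/t => tn.
have -> : 2 ^ t = 2 ^ (t - (t - q)) * 2 ^ (t - q) by rewrite -expnD subnK // leq_subr.
rewrite leq_mul2r expn_eq0 /=.
by rewrite leq_divRL ?expn_gt0 // -expnD subnK // leq_subr.
Qed.

Lemma dround_gt0 q n : 0 < n -> 0 < dround q n.
Proof. by move=> /(expn_trunc_log_le_dround q); apply: leq_trans; rewrite expn_gt0. Qed.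

Lemma dceil_lt q n : 0 < n -> dceil q n < 2 ^ (trunc_log 2 n).+1.
Proof.
move=> n0; rewrite /dceil /dround; set t := trunc_log 2 n.
have tn : n < 2 ^ t.+1 by apply: trunc_log_ltn.
rewrite -addnS prednK ?expn_gt0 // -mulSnr.
have -> : 2 ^ t.+1 = 2 ^ (t.+1 - (t - q)) * 2 ^ (t - q).
  by rewrite -expnD subnK // (leq_trans (leq_subr _ _)).
rewrite leq_mul2r expn_eq0 /= ltn_divLR ?expn_gt0 // -expnD subnK //.
by rewrite (leq_trans (leq_subr _ _)).
Qed.

Lemma trunc_log_dround q n : 0 < n -> trunc_log 2 (dround q n) = trunc_log 2 n.
Proof.
move=> n0; apply: trunc_log_eq => //; rewrite expn_trunc_log_le_dround //=.
by rewrite (leq_ltn_trans (dround_le q n)) // trunc_log_ltn.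
Qed.

Lemma trunc_log_dceil q n : 0 < n -> trunc_log 2 (dceil q n) = trunc_log 2 n.
Proof.
move=> n0; apply: trunc_log_eq => //; rewrite dceil_lt // andbT.
by rewrite (leq_trans (trunc_logP _ n0)) // dceil_ge.
Qed.

(** With t the binary logarithm of [n], the gap is less than 2^(t-q) while [dround q n] is at least
    2^t: the relative error is at most 2^-q. Denominators are cleared to stay in [nat]. *)
Lemma dceil_error q n : 0 < n ->
  2 ^ q * dceil q n <= 2 ^ q * dround q n + dround q n.
Proof.
move=> n0; rewrite /dceil mulnDr leq_add2l.
apply: leq_trans (expn_trunc_log_le_dround q n0).
set t := trunc_log 2 n; case: (leqP q t) => [qt|tq].
  rewrite -[X in _ <= 2 ^ X](subnKC qt) expnD leq_mul2l leq_pred orbT //.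
(* When [q] exceeds t nothing is rounded and the gap is 0. *)
by rewrite (eqP (ltnW tq : t - q == 0)) expn0 muln0.
Qed.

Lemma quotient_digits_lt q n : n %/ 2 ^ (trunc_log 2 n - q) < 2 ^ q.+1.
Proof.
rewrite ltn_divLR ?expn_gt0 // -expnD.
have := trunc_log_ltn n (isT : 1 < 2) => /leq_trans; apply.
by rewrite leq_exp2l //; lia.
Qed.

Lemma dround_id q n : trunc_log 2 n <= q -> dround q n = n.
Proof. by rewrite /dround -subn_eq0 => /eqP ->; rewrite expn0 divn1 muln1. Qed.

(** * Boxes, slabs and counting of rounded multi-indices *)

Section multi_index.
Variable dim : nat.
Implicit Types n p k : mindex dim.

Definition mlevel n : nat := \sum_(i < dim) trunc_log 2 (n i).
Definition mround q n : mindex dim := [ffun i => dround q (n i)].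
Definition mceil q n : mindex dim := [ffun i => dceil q (n i)].
Definition mle k n : bool := [forall i, k i <= n i].
(** Enumerated as in [Ssum], so that the partial sum is a sum over a duplicate-free sequence, the
    form that negative association works with. *)
Definition mbox n : seq (mindex dim) :=
  [seq [ffun i => (k i).+1] | k : {dffun forall i : 'I_dim, 'I_(n i)}].
(** For [p] below [n], the difference of two boxes: the increment of S from [p] to [n] is the sum
    over it. *)
Definition mslab p n : seq (mindex dim) := [seq k <- mbox n | ~~ mle k p].

Lemma mlevel_ge n i : trunc_log 2 (n i) <= mlevel n.
Proof. by rewrite /mlevel (bigD1 i) //= leq_addr. Qed.

Lemma mpos_mround q n : mpos n -> mpos (mround q n).
Proof. by move=> /forallP pn; apply/forallP => i; rewrite ffunE dround_gt0. Qed.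

Lemma mlevel_mround q n : mpos n -> mlevel (mround q n) = mlevel n.
Proof.
move=> /forallP pn; apply: eq_bigr => i _.
by rewrite ffunE trunc_log_dround.
Qed.

Lemma mpos_mceil q n : mpos n -> mpos (mceil q n).
Proof.
by move=> /forallP pn; apply/forallP => i; rewrite ffunE (leq_trans (pn i)) ?dceil_ge.
Qed.

Lemma mlevel_mceil q n : mpos n -> mlevel (mceil q n) = mlevel n.
Proof.
move=> /forallP pn; apply: eq_bigr => i _.
by rewrite ffunE trunc_log_dceil.
Qed.

Lemma mround_id q n : mlevel n <= q -> mround q n = n.
Proof.
move=> nq; apply/ffunP => i; rewrite ffunE dround_id //.
exact: leq_trans (mlevel_ge n i) nq.
Qed.

Lemma mround_le q n : mle (mround q n) n.
Proof. by apply/forallP => i; rewrite ffunE dround_le. Qed.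

Lemma mceil_ge q n : mle n (mceil q n).
Proof. by apply/forallP => i; rewrite ffunE dceil_ge. Qed.

Lemma mle_trans p k n : mle p k -> mle k n -> mle p n.
Proof.
move=> /forallP pk /forallP kn; apply/forallP => i; exact: leq_trans (pk i) (kn i).
Qed.

Lemma mlevel_le p n : mle p n -> mlevel p <= mlevel n.
Proof. by move=> /forallP pn; apply: leq_sum => i _; apply: leq_trunc_log. Qed.

Lemma expn_mlevel_le n : mpos n -> 2 ^ mlevel n <= msize n.
Proof.
move=> /forallP pn; rewrite /mlevel /msize expn_sum.
by apply: leq_prod => i _; apply: trunc_logP.
Qed.

Lemma msize_le n : msize n <= 2 ^ (mlevel n + dim).
Proof.
have -> : mlevel n + dim = \sum_(i < dim) (trunc_log 2 (n i)).+1.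
  rewrite -[X in _ + X]card_ord -sum1_card /mlevel -big_split /=.
  by apply: eq_bigr => i _; rewrite addn1.
rewrite expn_sum; apply: leq_prod => i _.
by apply: ltnW; apply: trunc_log_ltn.
Qed.

Lemma mem_mbox k n : (k \in mbox n) = mpos k && mle k n.
Proof.
apply/mapP/andP => [[j _ ->]|[/forallP pk /forallP kn]].
  by split; apply/forallP => i; rewrite ffunE.
have H i : (k i).-1 < n i by rewrite prednK ?pk // kn.
exists [ffun i => Ordinal (H i)]; first by rewrite mem_enum.
by apply/ffunP => i; rewrite !ffunE /= prednK.
Qed.

Lemma mbox_uniq n : uniq (mbox n).
Proof.
rewrite map_inj_uniq ?enum_uniq // => a b /ffunP ab; apply/ffunP => i.
by apply/val_inj; move: (ab i); rewrite !ffunE => -[].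
Qed.

Lemma size_mbox n : size (mbox n) = msize n.
Proof.
rewrite size_map -cardE /msize card_dep_ffun foldrE big_map.
rewrite big_enum /=; apply: eq_bigr => i _; exact: card_ord.
Qed.

Lemma mbox_pos n : all (@mpos dim) (mbox n).
Proof. by apply/allP => k; rewrite mem_mbox => /andP[]. Qed.

Lemma mslab_uniq p n : uniq (mslab p n).
Proof. by rewrite filter_uniq // mbox_uniq. Qed.

Lemma mslab_pos p n : all (@mpos dim) (mslab p n).
Proof. by apply/allP => k; rewrite mem_filter mem_mbox => /and3P[]. Qed.

Lemma perm_mbox_mslab p n : mle p n -> perm_eq (mbox n) (mbox p ++ mslab p n).
Proof.
move=> pn; apply: uniq_perm.
- exact: mbox_uniq.
- rewrite cat_uniq mbox_uniq mslab_uniq andbT /=; apply/hasPn => k.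
  by rewrite mem_filter !mem_mbox => /and3P[/negbTE -> _ _]; rewrite andbF.
- move=> k; rewrite mem_cat mem_filter !mem_mbox.
  case: (boolP (mle k p)) => /= kp; last by rewrite andbF.
  by rewrite (mle_trans kp pn) andbT orbF.
Qed.

Lemma size_mslab p n : mle p n -> size (mslab p n) = msize n - msize p.
Proof.
by move=> /perm_mbox_mslab/perm_size; rewrite size_cat !size_mbox => ->; rewrite addKn.
Qed.

Lemma mslab_subset p n n' : mle n n' -> {subset mslab p n <= mslab p n'}.
Proof.
move=> nn k; rewrite !mem_filter !mem_mbox => /and3P[-> ->] /= kn.
exact: mle_trans kn nn.
Qed.

(** The factors [a i] are replaced by [b i] one at a time; each replacement costs at most a fraction
    1/K of the full product. *)
Lemma prod_increment_bound K (I : Type) (s : seq I) (a b : I -> nat) :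
  (forall i, b i <= a i) -> (forall i, K * a i <= K * b i + a i) ->
  K * (\prod_(i <- s) a i) <=
    K * (\prod_(i <- s) b i) + size s * \prod_(i <- s) a i.
Proof.
move=> ba H; elim: s => [|i s IH]; first by rewrite !big_nil leq_addr.
rewrite !big_cons /=; have Hi := H i.
have BA : \prod_(j <- s) b j <= \prod_(j <- s) a j by apply: leq_prod.
set A := \prod_(j <- s) a j in IH BA *; set B := \prod_(j <- s) b j in IH BA *.
have h1 : a i * (K * A) <= a i * (K * B + size s * A) by rewrite leq_mul2l IH orbT.
have h2 : (K * a i) * B <= (K * b i + a i) * B by rewrite leq_mul2r Hi orbT.
have h3 : a i * B <= a i * A by rewrite leq_mul2l BA orbT.
nia.
Qed.

(** If every side shrinks by a relative amount of at most 2^-q, the slab is at most a fraction dim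
    2^-q of the box. *)
Lemma size_mslab_bound q p n : mle p n ->
  (forall i, 2 ^ q * n i <= 2 ^ q * p i + n i) ->
  2 ^ q * size (mslab p n) <= dim * msize n.
Proof.
move=> pn H; rewrite size_mslab // mulnBr leq_subLR.
have := prod_increment_bound (index_enum 'I_dim) (forallP pn) H.
rewrite /msize => /leq_trans -> //.
by rewrite leq_add2l leq_mul2r [index_enum _]unlock -enumT size_enum_ord leqnn orbT.
Qed.

Lemma size_mslab_mround q n : mpos n ->
  2 ^ q * size (mslab (mround q n) n) <= dim * msize n.
Proof.
move=> /forallP pn; apply: size_mslab_bound; first exact: mround_le.
move=> i; rewrite ffunE (leq_trans (leq_mul (leqnn _) (dceil_ge q (n i)))) //.
by rewrite (leq_trans (dceil_error _ (pn i))) // leq_add2l dround_le.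
Qed.

Lemma size_mslab_mceil q n : mpos n ->
  2 ^ q * size (mslab (mround q n) (mceil q n)) <= dim * msize (mceil q n).
Proof.
move=> /forallP pn; apply: size_mslab_bound.
  exact: mle_trans (mround_le q n) (mceil_ge q n).
move=> i; rewrite !ffunE (leq_trans (dceil_error _ (pn i))) // leq_add2l.
exact: leq_trans (dround_le _ _) (dceil_ge _ _).
Qed.

Definition mlogs m n : {ffun 'I_dim.-1 -> 'I_m.+1} :=
  [ffun i => inord (trunc_log 2 (n (widen_ord (leq_pred dim) i)))].

(** A finite code for the pair of roundings of an index of level [m]: its dyadic cell and the
    leading digits of its coordinates. On level [m] all values are in range, so [inord] loses
    nothing. The number of keys bounds the number of distinct events on the level. *)
Definition mkey m q n : {ffun 'I_dim.-1 -> 'I_m.+1} * {ffun 'I_dim -> 'I_(2 ^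
    q.+1).+1} :=
  (mlogs m n, [ffun i => inord (n i %/ 2 ^ (trunc_log 2 (n i) - q))]).

Lemma card_mkey m q :
  #|{: {ffun 'I_dim.-1 -> 'I_m.+1} * {ffun 'I_dim -> 'I_(2 ^ q.+1).+1}}| =
  m.+1 ^ dim.-1 * (2 ^ q.+1).+1 ^ dim.
Proof. by rewrite card_prod !card_ffun !card_ord. Qed.

(* The level pins down the last binary logarithm, so [dim.-1] of them suffice. *)
Lemma mlogs_inj m n n' : mlevel n = m -> mlevel n' = m ->
  mlogs m n = mlogs m n' -> forall i, trunc_log 2 (n i) = trunc_log 2 (n' i).
Proof.
move=> nm n'm /ffunP E.
have {}E (i : 'I_dim) : i < dim.-1 -> trunc_log 2 (n i) = trunc_log 2 (n' i).
  move=> idim; have := E (Ordinal idim); rewrite !ffunE.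
  have -> : widen_ord (leq_pred dim) (Ordinal idim) = i by apply/val_inj.
  move=> /(congr1 (@nat_of_ord _)); rewrite !inordK // ltnS.
  - by rewrite -n'm mlevel_ge.
  - by rewrite -nm mlevel_ge.
move=> i; case: (ltnP i dim.-1) => [/E //|idim].
have : mlevel n = mlevel n' by rewrite nm n'm.
rewrite /mlevel (bigD1 i) //= [RHS](bigD1 i) //=.
have -> : \sum_(j < dim | j != i) trunc_log 2 (n j) =
          \sum_(j < dim | j != i) trunc_log 2 (n' j).
  apply: eq_bigr => j ji; apply: E.
  have := ltn_ord j; have := ltn_ord i; move: ji; rewrite -val_eqE /=; lia.
by move/addIn.
Qed.

Lemma mkey_inj m q n n' : mlevel n = m -> mlevel n' = m ->
  mkey m q n = mkey m q n' ->
  mround q n = mround q n' /\ mceil q n = mceil q n'.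
Proof.
move=> nm n'm [/(mlogs_inj nm n'm) El /ffunP Eq].
have E i : dround q (n i) = dround q (n' i).
  rewrite /dround El; congr (_ * _).
  have := Eq i; rewrite !ffunE => /(congr1 (@nat_of_ord _)).
  have b (x : nat) : x %/ 2 ^ (trunc_log 2 x - q) < (2 ^ q.+1).+1.
    by rewrite ltnS ltnW // quotient_digits_lt.
  by rewrite inordK // inordK // El.
by split; apply/ffunP => i; rewrite !ffunE /dceil E // El.
Qed.

Definition mval (M : nat) (f : {ffun 'I_dim -> 'I_M}) : mindex dim :=
  [ffun i => nat_of_ord (f i)].

Lemma card_ord_trunc_log M j : #|[pred a : 'I_M | trunc_log 2 a == j]| <= 2 ^ j.+1.
Proof.
rewrite cardE -(size_map val) -[X in _ <= X](size_iota 0).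
apply: uniq_leq_size; first by rewrite map_inj_uniq ?enum_uniq //; exact: val_inj.
move=> x /mapP[a]; rewrite mem_enum inE => /eqP <- ->.
by rewrite mem_iota /= add0n trunc_log_ltn.
Qed.

(** The indices of level [m] are sorted by dyadic cell. There are at most [m.+1 ^ dim.-1] cells, and
    each lies in a product of sets of at most 2^(t_i + 1) integers, where the t_i sum to [m]. The
    bound does not depend on [M], which only makes the type finite. *)
Lemma card_level m M :
  #|[pred f : {ffun 'I_dim -> 'I_M} | mlevel (mval f) == m]| <=
  m.+1 ^ dim.-1 * 2 ^ (m + dim).
Proof.
set S := [pred f | _].
rewrite -sum1_card (partition_big (fun f => mlogs m (mval f)) xpredT) //=.
have -> : m.+1 ^ dim.-1 = #|{: {ffun 'I_dim.-1 -> 'I_m.+1}}|.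
  by rewrite card_ffun !card_ord.
rewrite -sum_nat_const.
apply: leq_sum => k _; rewrite sum1_card.
case: (pickP [pred f | (f \in S) && (mlogs m (mval f) == k)]) => /= [f0|H]; last first.
  by rewrite (eq_card0 H).
move=> /andP[/eqP f0m /eqP f0k].
apply: (@leq_trans #|family (fun i => [pred a : 'I_M | trunc_log 2 a == trunc_log 2
    (f0 i)])|).
  apply: subset_leq_card; apply/fintype.subsetP => f; rewrite unfold_in => /andP[/eqP
      fm /eqP fk].
  apply/familyP => i; rewrite inE; apply/eqP.
  have := mlogs_inj fm f0m; rewrite fk f0k => /(_ erefl i).
  by rewrite !ffunE.
rewrite card_family foldrE big_map.
have -> : 2 ^ (m + dim) = \prod_(i < dim) 2 ^ (trunc_log 2 (f0 i)).+1.
  rewrite -expn_sum -f0m; congr (2 ^ _).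
  rewrite -[X in _ + X]card_ord -sum1_card /mlevel -big_split /=.
  by apply: eq_bigr => i _; rewrite addn1 ffunE.
rewrite big_enum; apply: leq_prod => i _; exact: card_ord_trunc_log.
Qed.

(** The levels grow geometrically, so all those up to [m] together cost a factor 2 over the last
    one. *)
Lemma card_level_le m M :
  #|[pred f : {ffun 'I_dim -> 'I_M} | mlevel (mval f) <= m]| <=
  m.+1 ^ dim.-1 * 2 ^ (m.+1 + dim).
Proof.
elim: m => [|m IH].
  apply: (@leq_trans (1 ^ dim.-1 * 2 ^ (0 + dim))).
    apply: leq_trans (card_level 0 M).
    by apply: subset_leq_card; apply/fintype.subsetP => f; rewrite !inE leqn0.
  by rewrite leq_mul2l leq_exp2l // leq_add2r orbT.
apply: (@leq_trans (#|[pred f : {ffun 'I_dim -> 'I_M} | mlevel (mval f) <= m]| +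
    #|[pred f : {ffun 'I_dim -> 'I_M} | mlevel (mval f) == m.+1]|)).
  rewrite -cardUI (leq_trans _ (leq_addr _ _)) //.
  apply: subset_leq_card; apply/fintype.subsetP => f; rewrite !inE.
  by rewrite leq_eqVlt ltnS orbC.
apply: (leq_trans (leq_add IH (card_level m.+1 M))).
rewrite [2 ^ (m.+2 + dim)]expnS mul2n -addnn mulnDr leq_add2r leq_mul2r.
by case: dim.-1 => [|k]; rewrite ?expn0 ?orbT // leq_exp2r // leqnSn orbT.
Qed.
End multi_index.
End binary_levels.

(** * Exponential moments and tails *)

Section real_bounds.
Variable R : realType.
Implicit Types x y t u c b : R.

(** The difference [G] of the two sides vanishes at 0, increases on [0, c] and decreases on the
    negative axis, so it is nonnegative up to [c]. *)
Lemma expR_le_quadratic u c : 0 <= c -> u <= c ->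
  expR u <= 1 + u + u ^+ 2 / 2 * expR c.
Proof.
move=> c0 uc.
pose G v := 1 + v + v ^+ 2 / 2 * expR c - expR v.
have dG (v : R) : is_derive v (1 : R) G (1 + v * expR c - expR v).
  rewrite /G; apply: is_derive_eq.
  by rewrite /GRing.scale /=; field.
have cG : continuous (G : R -> R).
  by move=> v; apply: differentiable_continuous; apply/derivable1_diffP; case: (dG v).
have K1 : 1 <= expR c by rewrite -expR0 ler_expR.
suff : 0 <= G u by rewrite /G subr_ge0.
have G0 : G 0 = 0 by rewrite /G expr0n /= mul0r mul0r !addr0 expR0 subrr.
rewrite -[leLHS]G0; case: (leP 0 u) => u0.
  apply: (@ger0_derive1_ndecr _ G 0 u) => //.
  - move=> v; rewrite in_itv /= => /andP[v0 vu].
    rewrite derive1E; have -> := @derive_val _ _ _ _ _ _ _ (dG v).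
    rewrite subr_ge0.
    (* The derivative is nonnegative because e^v - 1 <= v e^v <= v e^c. *)
    have h1 : 1 - v <= expR (- v) by rewrite (le_trans _ (expR_ge1Dx (- v))).
    have h2 : (1 - v) * expR v <= 1.
      by have := ler_wpM2r (expR_ge0 v) h1; rewrite -expRD addNr expR0.
    have h3 : v * expR v <= v * expR c.
      by rewrite ler_wpM2l ?(ltW v0) // ler_expR (le_trans (ltW vu)).
    lra.
  - exact: continuous_subspaceT.
apply: (@ler0_derive1_nincr _ G u 0) => //; last exact: ltW.
- move=> v; rewrite in_itv /= => /andP[uv v0].
  rewrite derive1E; have -> := @derive_val _ _ _ _ _ _ _ (dG v).
  rewrite subr_le0 (le_trans _ (expR_ge1Dx v)) // lerD2l.
  by rewrite -[leRHS]mulr1 ler_wnM2l // ltW.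
- exact: continuous_subspaceT.
Qed.

Lemma Log_ge1 x : 1 <= Log x.
Proof.
rewrite /Log -[leLHS]expRK ler_ln ?posrE ?expR_gt0 //.
  by rewrite le_max lexx orbT.
by rewrite lt_max expR_gt0 orbT.
Qed.

Lemma Log_gt0 x : 0 < Log x. Proof. exact: lt_le_trans (Log_ge1 x). Qed.

Lemma Log_ge_ln x : 0 < x -> ln x <= Log x.
Proof.
by move=> x0; rewrite /Log ler_ln ?posrE // ?lt_max ?x0 // le_max lexx.
Qed.

Lemma ler_Log x y : x <= y -> Log x <= Log y.
Proof.
move=> xy; rewrite /Log ler_ln ?posrE ?lt_max ?expR_gt0 ?orbT //.
by rewrite ge_max !le_max xy lexx orbT.
Qed.

(** From ln u = 2 ln (sqrt u) and ln z < z; below e the left side is 1. *)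
Lemma LogLog_le x : Log (Log x) <= 2 * Num.sqrt (Log x).
Proof.
have u1 := Log_ge1 x; set u := Log x in u1 *.
have s1 : 1 <= Num.sqrt u by rewrite -sqrtr1 ler_sqrt // (le_trans _ u1).
have s0 : 0 < Num.sqrt u by exact: lt_le_trans s1.
rewrite /Log; case: (leP u (expR 1)) => ue.
  by rewrite expRK; lra.
rewrite -[u in ln u]sqr_sqrtr ?(le_trans _ u1) // lnXn // mulr2n.
by have := ln_sublinear s0; lra.
Qed.

(** Applied with [D = dim.-1], this is where d >= 2 enters: one power of the logarithm over log log
    still dominates its square root, and the Chernoff estimates use only that much beyond the second
    moment. *)
Lemma moment_weight_ge x (D : nat) : (0 < D)%N ->
  x ^+ 2 * Num.sqrt (Log `|x|) <= 2 * (x ^+ 2 * Log `|x| ^+ D / Log (Log `|x|)).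
Proof.
move=> D0; set u := Log `|x|.
have u1 : 1 <= u by exact: Log_ge1.
have u0 : 0 <= u by exact: le_trans u1.
have LL0 : 0 < Log u by exact: Log_gt0.
rewrite -mulrA mulrCA ler_wpM2l ?sqr_ge0 // mulrA ler_pdivlMr //.
apply: (@le_trans _ _ (Num.sqrt u * (2 * Num.sqrt u))).
  by rewrite ler_wpM2l ?sqrtr_ge0 // LogLog_le.
rewrite mulrCA -expr2 sqr_sqrtr // ler_wpM2l //.
by rewrite -[leLHS]expr1 ler_weXn2l.
Qed.
End real_bounds.

(** * Truncated exponential moments and tails *)

Section moments.
Context d (T : measurableType d) (R : realType) (P : probability T R).
Variable Y : T -> R.
Hypothesis mY : measurable_fun setT Y.

Lemma measurable_gt_preimage (b : R) : measurable [set w | b < Y w].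
Proof.
rewrite (_ : [set w | _] = setT `&` Y @^-1` `]b, +oo[%classic).
  by apply: mY.
by apply/seteqP; split => w /=; rewrite in_itv /= andbT => // -[].
Qed.

(** Two cuts are at work. Below [b] the quadratic bound for the exponential applies, with inflation
    e^(tb); above [b] the truncation at [y], possibly much larger, leaves at most e^(ty), paid only
    with probability [pb]. *)
Lemma mgf_min_le (s2 t b y pb : R) :
  P.-integrable setT (EFin \o Y) -> (\int[P]_w (Y w)%:E = 0)%E ->
  (\int[P]_w (Y w ^+ 2)%:E <= s2%:E)%E ->
  0 <= t -> 0 <= b -> (P [set w | (b < Y w)%R] <= pb%:E)%E ->
  (\int[P]_w (expR (t * Num.min (Y w) y))%:E <=
    (expR (t ^+ 2 * s2 / 2 * expR (t * b) + expR (t * y) * pb))%:E)%E.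
Proof.
move=> iY EY EY2 t0 b0 hpb.
set A := [set w | b < Y w] in hpb *.
have mA : measurable A by exact: measurable_gt_preimage.
set K := t ^+ 2 / 2 * expR (t * b).
have K0 : 0 <= K by rewrite mulr_ge0 ?expR_ge0 // divr_ge0 // sqr_ge0.
(* The linear term [t * Y w] is kept even where Y > b, where it is nonnegative, so that its integral
   is exactly 0. *)
have pt w : expR (t * Num.min (Y w) y) <=
    1 + t * Y w + K * Y w ^+ 2 + expR (t * y) * \1_A w.
  rewrite indicE; case: (boolP (w \in A)) => [|]; rewrite ?inE ?notin_setE /A /= => wA.
    have : expR (t * Num.min (Y w) y) <= expR (t * y).
      by rewrite ler_expR ler_wpM2l // ge_min lexx orbT.
    have : 0 <= K * Y w ^+ 2 by rewrite mulr_ge0 // sqr_ge0.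
    have : 0 <= t * Y w by rewrite mulr_ge0 // (le_trans b0) // ltW.
    by rewrite mulr1; lra.
  rewrite mulr0 addr0; move/negP: wA; rewrite -leNgt => wA.
  apply: (@le_trans _ _ (expR (t * Y w))).
    by rewrite ler_expR ler_wpM2l // ge_min lexx.
  have := @expR_le_quadratic R (t * Y w) (t * b).
  move=> /(_ (mulr_ge0 t0 b0) (ler_wpM2l t0 wA)) /le_trans; apply.
  by rewrite /K exprMn; lra.
have iY2 : P.-integrable setT (EFin \o (fun w => Y w ^+ 2)).
  apply/integrableP; split.
    by apply/measurable_EFinP; exact: measurable_funX.
  apply: le_lt_trans (ltry s2); apply: le_trans EY2.
  rewrite le_eqVlt; apply/orP; left; apply/eqP; apply: eq_integral => w _.
  by rewrite /= ger0_norm // sqr_ge0.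
have iA : P.-integrable setT (EFin \o \1_A).
  by apply: integrable_indic => //; rewrite (le_lt_trans (probability_le1 _ _)) ?ltry.
have i1 : P.-integrable setT (EFin \o (fun=> 1 : R)).
  exact: finite_measure_integrable_cst.
have itY : P.-integrable setT (EFin \o (fun w => t * Y w)).
  by rewrite (_ : _ \o _ = (fun w => t%:E * (EFin \o Y) w)%E) //; exact: integrableZl.
have iKY : P.-integrable setT (EFin \o (fun w => K * Y w ^+ 2)).
  rewrite (_ : _ \o _ = (fun w => K%:E * (EFin \o (fun w => (Y w ^+ 2)%R)) w)%E) //.
  exact: integrableZl.
have iEA : P.-integrable setT (EFin \o (fun w => expR (t * y) * \1_A w)).
  rewrite (_ : _ \o _ = (fun w => (expR (t * y))%:E * (EFin \o \1_A) w)%E) //.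
  exact: integrableZl.
have i2 : P.-integrable setT (EFin \o (fun w => 1 + t * Y w)).
  exact: (integrableD measurableT i1 itY).
have i3 : P.-integrable setT (EFin \o (fun w => 1 + t * Y w + K * Y w ^+ 2)).
  exact: (integrableD measurableT i2 iKY).
have HI : (\int[P]_w (1 + t * Y w + K * Y w ^+ 2 + expR (t * y) * \1_A w)%:E <=
   (1 + K * s2 + expR (t * y) * pb)%:E)%E.
  rewrite (integralD_EFin measurableT i3 iEA) (integralD_EFin measurableT i2 iKY).
  rewrite (integralD_EFin measurableT i1 itY).
  have -> : (\int[P]_x (EFin \o (fun w => (t * Y w)%R)) x = 0)%E.
    by rewrite (integralZl measurableT iY) EY mule0.
  have -> : (\int[P]_x (EFin \o (fun=> 1%R : R)) x = 1)%E.
    by rewrite integral_cst //= probability_setT mule1.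
  rewrite (integralZl measurableT iY2) (integralZl measurableT iA).
  have -> : (\int[P]_x (EFin \o \1_A) x = P A)%E by rewrite integral_indic // setIT.
  rewrite adde0 EFinD EFinD; apply: leeD; first apply: leeD => //.
    by rewrite [leRHS]EFinM; apply: lee_wpmul2l; rewrite ?lee_fin.
  by rewrite EFinM; apply: lee_wpmul2l; rewrite ?lee_fin ?expR_ge0.
apply: (@le_trans _ _ (1 + K * s2 + expR (t * y) * pb)%:E); last first.
  rewrite lee_fin -addrA (le_trans (expR_ge1Dx _)) // ler_expR /K.
  by rewrite lerD2r; lra.
apply: le_trans HI; apply: (@ge0_le_integral _ _ _ P _ measurableT).
- by move=> w _; rewrite lee_fin expR_ge0.
- apply/measurable_EFinP; apply: (measurableT_comp (@measurable_expR R)).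
  by apply: measurable_funM => //; exact: measurable_minr.
- by have /measurable_int := integrableD measurableT i3 iEA.
- by move=> w _; rewrite lee_fin.
Qed.

(** The truncated excess is 0 off the event Y > c, so the exponential moment differs from 1 by at
    most e^(ty) times the tail. *)
Lemma mgf_excess_le (t c y pc : R) : 0 <= t -> 0 <= y ->
  (P [set w | (c < Y w)%R] <= pc%:E)%E ->
  (\int[P]_w (expR (t * Num.min (Num.max (Y w - c) 0) y))%:E <=
    (expR (expR (t * y) * pc))%:E)%E.
Proof.
move=> t0 y0 hpc; set A := [set w | c < Y w] in hpc *.
have mA : measurable A by exact: measurable_gt_preimage.
have pt w : expR (t * Num.min (Num.max (Y w - c) 0) y) <=
    1 + expR (t * y) * \1_A w.
  rewrite indicE; case: (boolP (w \in A)) => [|]; rewrite ?inE ?notin_setE /A /= => wA.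
    rewrite mulr1 (@le_trans _ _ (expR (t * y))) ?lerDr //.
    by rewrite ler_expR ler_wpM2l // ge_min lexx orbT.
  rewrite mulr0 addr0; move/negP: wA; rewrite -leNgt => wA.
  rewrite (max_idPr _) ?subr_le0 // (min_idPl y0).
  by rewrite mulr0 expR0.
have iA : P.-integrable setT (EFin \o \1_A).
  by apply: integrable_indic => //; rewrite (le_lt_trans (probability_le1 _ _)) ?ltry.
have i1 : P.-integrable setT (EFin \o (fun=> 1 : R)).
  exact: finite_measure_integrable_cst.
have iEA : P.-integrable setT (EFin \o (fun w => expR (t * y) * \1_A w)).
  rewrite (_ : _ \o _ = (fun w => (expR (t * y))%:E * (EFin \o \1_A) w)%E) //.
  exact: integrableZl.
apply: (@le_trans _ _ (\int[P]_w (1 + expR (t * y) * \1_A w)%:E)%E); last first.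
  rewrite (integralD_EFin measurableT i1 iEA).
  have -> : (\int[P]_x (EFin \o (fun=> 1%R : R)) x = 1)%E.
    by rewrite integral_cst //= probability_setT mule1.
  rewrite (integralZl measurableT iA).
  have -> : (\int[P]_x (EFin \o \1_A) x = P A)%E by rewrite integral_indic // setIT.
  apply: (@le_trans _ _ (1 + expR (t * y) * pc)%:E); last first.
    by rewrite lee_fin expR_ge1Dx.
  by rewrite EFinD EFinM leeD //; apply: lee_wpmul2l; rewrite ?lee_fin ?expR_ge0.
apply: (@ge0_le_integral _ _ _ P _ measurableT).
- by move=> w _; rewrite lee_fin expR_ge0.
- apply/measurable_EFinP; apply: (measurableT_comp (@measurable_expR R)).
  apply: measurable_funM => //; apply: measurable_minr => //.
  by apply: measurable_maxr => //; exact: measurable_funB.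
- by have /measurable_int := integrableD measurableT i1 iEA.
- by move=> w _; rewrite lee_fin.
Qed.

Lemma measurable_Log : measurable_fun setT (@Log R).
Proof.
apply: (measurableT_comp (@measurable_ln R)).
exact: measurable_maxr.
Qed.

Lemma measurable_sqrtr : measurable_fun setT (@Num.sqrt R).
Proof. by apply: continuous_measurable_fun; exact: sqrt_continuous. Qed.

(** Markov's inequality with the weight x^2 sqrt(Log |x|), which is nondecreasing in |x|. *)
Lemma tail_le (H b : R) : 0 < b ->
  (\int[P]_w (Y w ^+ 2 * Num.sqrt (Log `|Y w|))%:E <= H%:E)%E ->
  (P [set w | (b < Y w)%R] <= (H / (b ^+ 2 * Num.sqrt (Log b)))%:E)%E.
Proof.
move=> b0 HH; set A := [set w | b < Y w].
have mA : measurable A by exact: measurable_gt_preimage.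
have K0 : 0 < b ^+ 2 * Num.sqrt (Log b).
  by rewrite mulr_gt0 ?exprn_gt0 // sqrtr_gt0 Log_gt0.
rewrite EFinM lee_pdivlMr // muleC.
have -> : P A = (\int[P]_w (\1_A w)%:E)%E.
  by rewrite (integral_indic P measurableT mA) setIT.
rewrite -(ge0_integralZl P measurableT); last 3 first.
- by apply/measurable_EFinP.
- by move=> w _; rewrite lee_fin.
- by rewrite lee_fin ltW.
apply: le_trans HH; apply: (@ge0_le_integral _ _ _ P _ measurableT).
- by move=> w _; rewrite -EFinM lee_fin mulr_ge0 // ltW.
- by apply/measurable_EFinP; exact: measurable_funM.
- apply/measurable_EFinP; apply: measurable_funM; first exact: measurable_funX.
  apply: (measurableT_comp measurable_sqrtr).
  apply: (measurableT_comp measurable_Log).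
  exact: measurableT_comp (@normr_measurable R setT) mY.
- move=> w _; rewrite -EFinM lee_fin indicE.
  case: (boolP (w \in A)) => [|]; rewrite ?inE ?notin_setE /A /= => wA; last first.
    by rewrite mulr0 mulr_ge0 ?sqr_ge0 ?sqrtr_ge0.
  have Yb : b <= `|Y w| by rewrite (le_trans (ltW wA)) // ler_norm.
  rewrite mulr1 ler_pM ?sqr_ge0 ?sqrtr_ge0 //.
    by rewrite ler_sqr ?nnegrE ?(ltW b0) // ?(ltW (lt_trans b0 wA)) // ltW.
  by rewrite ler_sqrt ?ler_Log // ltW // Log_gt0.
Qed.
End moments.

(** * Union bounds and the Borel-Cantelli lemma *)

Section union_bounds.
Context d (T : measurableType d) (R : realType) (P : probability T R).

Lemma measure_bigsetU_seq_le (I : Type) (s : seq I) (F : I -> set T) :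
  (forall i, measurable (F i)) ->
  (P (\big[setU/set0]_(i <- s) F i) <= \sum_(i <- s) P (F i))%E.
Proof.
move=> mF; elim: s => [|i s IH]; first by rewrite !big_nil measure0.
rewrite !big_cons; apply: (@le_trans _ _ (P (F i) + P (\big[setU/set0]_(j <- s) F
    j))%E).
  by apply: measureU2 => //; exact: bigsetU_measurable.
exact: leeD.
Qed.

(** The index set may be infinite: one event is chosen per key, and only the keys are counted. *)
Lemma finite_union_bound (K : finType) (I : Type) (key : I -> K) (S : set I)
    (E : I -> set T) (u : R) : 0 <= u ->
  (forall i j, S i -> S j -> key i = key j -> E i = E j) ->
  (forall i, S i -> measurable (E i) /\ (P (E i) <= u%:E)%E) ->
  exists F, [/\ measurable F, forall i, S i -> E i `<=` F &
    (P F <= (#|K|%:R * u)%:E)%E].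
Proof.
move=> u0 keyE HE.
have /choice[G HG] : forall k, exists G : set T, [/\ measurable G,
    (P G <= u%:E)%E & forall i, S i -> key i = k -> E i = G].
  move=> k.
  have [[i [Si ik]]|H] := pselect (exists i, S i /\ key i = k).
    have [mE PE] := HE _ Si; exists (E i); split => // j Sj jk.
    by apply: keyE => //; rewrite ik jk.
  exists set0; split; rewrite ?measure0 ?lee_fin //.
  by move=> i Si ik; exfalso; apply: H; exists i.
exists (\big[setU/set0]_(k : K) G k); split.
- by apply: bigsetU_measurable => k _; have [] := HG k.
- move=> i Si; have [_ _ /(_ i Si erefl) ->] := HG (key i).
  by rewrite (bigD1 (key i)) //=; exact: subsetUl.
- apply: (le_trans (measure_bigsetU_seq_le _ _)).
    by move=> k; have [] := HG k.
  apply: (@le_trans _ _ (\sum_(k : K) u%:E)%E).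
    by apply: lee_sum => k _; have [] := HG k.
  by rewrite sumEFin lee_fin sumr_const mulr_natl.
Qed.

(** The events [E m] need not be measurable, only covered by measurable sets of small probability.
    Bounded partial sums express convergence of the series. *)
Lemma borel_cantelli_eventually (E : nat -> set T) (u : nat -> R) (B : R) m0 :
  (forall m, (m0 <= m)%N ->
    exists F, [/\ measurable F, E m `<=` F & (P F <= (u m)%:E)%E]) ->
  (forall n, \sum_(m0 <= m < n) u m <= B) ->
  {ae P, forall w, exists M : nat, forall m, (M <= m)%N -> ~ E m w}.
Proof.
move=> HE HB.
have /choice[F HF] : forall m, exists F : set T, measurable F /\
   ((m0 <= m)%N -> E m `<=` F /\ (P F <= (u m)%:E)%E).
  move=> m.
  case: (leqP m0 m) => m0m; last by exists set0.
  by have [F [mF EF PF]] := HE m m0m; exists F.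
(* Nothing is known of the covers before [m0]; they are replaced by the empty set, which leaves the
   limsup set unchanged. *)
pose F' m := if (m0 <= m)%N then F m else set0.
have mF' m : measurable (F' m).
  by rewrite /F'; case: ifP => // _; have [] := HF m.
have S0 : P (lim_sup_set F') = 0%E.
  apply: lim_sup_set_cvg0 => //; apply: le_lt_trans (ltry B).
  apply: lime_le; first by apply: is_cvg_nneseries => n _ _; exact: measure_ge0.
  apply: nearW => n; apply: (@le_trans _ _ (\sum_(m0 <= m < n) u m)%:E); last first.
    by rewrite lee_fin.
  rewrite -sumEFin big_mkcond [leRHS]big_mkcond /=.
  case: (leqP m0 n) => m0n; last first.
    rewrite [leRHS]big_geq ?(ltnW m0n) //= big_nat big1 // => i /andP[_ ilt].
    by rewrite /F' leqNgt (ltn_trans ilt m0n) measure0.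
  rewrite (big_cat_nat (n := m0)) //= big_nat big1 ?add0e; last first.
    by move=> i /andP[_ ilt]; rewrite /F' leqNgt ilt measure0.
  rewrite big_nat [leRHS]big_nat; apply: lee_sum => i /andP[m0i _].
  by rewrite /F' m0i; have [_ /(_ m0i)[]] := HF i.
exists (lim_sup_set F'); split => //.
  by apply: bigcap_measurable => // n _; apply: bigcup_measurable.
move=> w /= H n _ /=; apply: contrapT => Hn; apply: H.
exists (maxn n m0) => m; rewrite geq_max => /andP[nm m0m] Ew; apply: Hn.
exists m => //; rewrite /F' m0m.
by have [_ /(_ m0m)[]] := HF m => + _; exact.
Qed.

(** Telescoping: with g(m) = m^(-rho), concavity of the logarithm gives rho m^(-1-rho) <= g(m-1) -
    g(m). Starting at 2 keeps m - 1 >= 1, where g is at most 1. *)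
Lemma sum_power_le (rho : R) m0 n : 0 < rho -> (2 <= m0)%N ->
  \sum_(m0 <= m < n) expR (- (1 + rho) * ln m%:R) <= rho^-1.
Proof.
move=> rho0 m02; pose g (k : nat) : R := expR (- rho * ln k%:R).
have g0 k : 0 <= g k by exact: expR_ge0.
have step m : (2 <= m)%N ->
    rho * expR (- (1 + rho) * ln m%:R) <= g m.-1 - g m.
  case: m => [//|m] m1 /=; have mR : 0 < m%:R :> R by rewrite ltr0n; lia.
  have m1R : 0 < m.+1%:R :> R by rewrite ltr0n.
  have H1 : m.+1%:R^-1 <= ln m.+1%:R - ln m%:R :> R.
    have := @le_ln1Dx R (- m.+1%:R^-1).
    rewrite ltrN2 invf_lt1 // ltr1n => /(_ _).
    have -> : 1 - m.+1%:R^-1 = m%:R / m.+1%:R :> R.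
      by rewrite -[m%:R](addrK 1) natr1 mulrBl mulfV ?gt_eqF // mul1r.
    rewrite ln_div ?posrE // => /(_ _); move: m1; case: m mR m1R => // m _ _ _.
    by move=> /(_ isT) h; rewrite -[leRHS]opprB lerNr.
  have -> : g m = expR (- rho * ln m.+1%:R) * expR (rho * (ln m.+1%:R - ln m%:R)).
    by rewrite -expRD /g; congr expR; ring.
  have -> : expR (- (1 + rho) * ln m.+1%:R) = expR (- rho * ln m.+1%:R) * m.+1%:R^-1.
    rewrite -[m.+1%:R^-1]lnK ?posrE ?invr_gt0 // -expRD lnV ?posrE //.
    by congr expR; ring.
  have -> : g m.+1 = expR (- rho * ln m.+1%:R) by [].
  rewrite -[X in _ - X]mulr1 -mulrBr mulrCA ler_wpM2l ?expR_ge0 //.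
  rewrite lerBrDl (le_trans _ (expR_ge1Dx _)) // lerD2l.
  by rewrite ler_wpM2l // ltW.
have {step} H k : rho * \sum_(m0 <= m < m0 + k) expR (- (1 + rho) * ln m%:R) <=
    g m0.-1 - g (m0 + k).-1.
  elim: k => [|k IH]; first by rewrite addn0 big_geq // mulr0 subrr.
  rewrite addnS big_nat_recr ?leq_addr //= mulrDr.
  have := step (m0 + k)%N (leq_trans m02 (leq_addr _ _)).
  by lra.
have g1 : g m0.-1 <= 1.
  have m1 : 1 <= m0.-1%:R :> R by rewrite (ler_nat _ 1%N); lia.
  by rewrite /g -[leRHS]expR0 ler_expR mulNr oppr_le0 mulr_ge0 ?(ltW rho0) // ln_ge0.
rewrite -(ler_pM2l rho0) mulfV ?gt_eqF //.
case: (leqP m0 n) => [m0n|nm0]; last by rewrite big_geq ?(ltnW nm0) // mulr0.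
rewrite -(subnKC m0n) (le_trans (H _)) //.
by have := g0 (m0 + (n - m0)).-1%N; lra.
Qed.

Lemma borel_cantelli_power (E : nat -> set T) (K rho : R) m0 :
  0 <= K -> 0 < rho ->
  (forall m, (m0 <= m)%N -> exists F, [/\ measurable F, E m `<=` F &
     (P F <= (K * expR (- (1 + rho) * ln m%:R))%:E)%E]) ->
  {ae P, forall w, exists M : nat, forall m, (M <= m)%N -> ~ E m w}.
Proof.
move=> K0 rho0 HE.
apply: (@borel_cantelli_eventually E (fun m => K * expR (- (1 + rho) * ln m%:R))
  (K / rho) (maxn m0 2)).
  by move=> m; rewrite geq_max => /andP[+ _]; exact: HE.
move=> n; rewrite -mulr_sumr ler_wpM2l // sum_power_le //.
by rewrite leq_max orbT.
Qed.

Lemma ae_and (Q1 Q2 : T -> Prop) : {ae P, forall w, Q1 w} -> {ae P, forall w, Q2 w} ->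
  {ae P, forall w, Q1 w /\ Q2 w}.
Proof. by move=> h1 h2; exact: filterI. Qed.

Lemma ae_forall_nat (Q : nat -> T -> Prop) : (forall k, {ae P, forall w, Q k w}) ->
  {ae P, forall w, forall k, Q k w}.
Proof.
move=> H.
have /choice[N HN] : forall k, exists N : set T,
    [/\ measurable N, P N = 0%E & ~` [set w | Q k w] `<=` N] by exact: H.
exists (\bigcup_k N k); split.
- by apply: bigcup_measurable => k _; have [] := HN k.
- apply/eqP; rewrite -measure_le0; apply: (@le_trans _ _ (\sum_(0 <= k <oo) P (N
    k))%E); last first.
    by rewrite eseries0 // => k _ _; have [] := HN k.
  apply: measure_sigma_subadditive => //.
  + by move=> k; have [] := HN k.
  + by apply: bigcup_measurable => k _; have [] := HN k.
- move=> w /= /existsNP[k Qk]; exists k => //.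
  by have [_ _] := HN k; apply.
Qed.
End union_bounds.

(** * Asymptotics in the level *)

Section asymptotics.
Variable R : realType.

(** Stands in for log log |n| on level [m]; e^(k lnn m) is m^k. *)
Definition lnn (m : nat) : R := ln m%:R.

Definition tail_bound (H b : R) : R := H / (b ^+ 2 * Num.sqrt (Log b)).

Lemma tail_bound_ge0 H b : 0 <= H -> 0 <= tail_bound H b.
Proof.
by move=> H0; rewrite /tail_bound divr_ge0 // mulr_ge0 ?sqr_ge0 ?sqrtr_ge0.
Qed.

Lemma ln2_gt0 : 0 < ln 2 :> R.
Proof. by rewrite ln_gt0 // ltr1n. Qed.

Lemma ln2_le1 : ln 2 <= 1 :> R.
Proof. by have := @le_ln1Dx R 1; rewrite -[1 + 1]/(2%:R); apply; lra. Qed.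

Lemma exp2nE (m : nat) : 2 ^+ m = expR (ln 2 * m%:R) :> R.
Proof. by rewrite mulrC expRM_natl lnK // posrE. Qed.

Lemma expR_lnn m : (0 < m)%N -> expR (lnn m) = m%:R.
Proof. by move=> m0; rewrite /lnn lnK // posrE ltr0n. Qed.

Lemma lnn_le m : lnn m <= m%:R.
Proof.
case: m => [|m]; first by rewrite /lnn ln0.
by apply: ltW; apply: ln_sublinear; rewrite ltr0n.
Qed.

Lemma lnn_large (A : R) : exists m0, forall m, (m0 <= m)%N -> A <= lnn m.
Proof.
exists (Num.bound (expR A)) => m hm.
have mA : expR A <= m%:R.
  by rewrite ltW // (lt_le_trans (archi_boundP (expR_ge0 A))) // ler_nat.
have m0 : 0 < m%:R :> R by exact: lt_le_trans (expR_gt0 A) mA.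
by rewrite -[A]expRK /lnn ler_ln ?posrE ?expR_gt0.
Qed.

Lemma linear_le_expR (a k : R) : 0 < a -> 0 < k ->
  exists m0, forall m, (m0 <= m)%N -> m%:R <= a * expR (k * m%:R).
Proof.
move=> a0 k0; have K0 : 0 <= 2 / (a * k ^+ 2).
  by rewrite divr_ge0 // mulr_ge0 ?sqr_ge0 // ltW.
exists (Num.bound (2 / (a * k ^+ 2))) => m hm.
have mA : 2 / (a * k ^+ 2) <= m%:R.
  by rewrite ltW // (lt_le_trans (archi_boundP K0)) // ler_nat.
have km0 : 0 <= k * m%:R by rewrite mulr_ge0 // ltW.
have h := @expR_ge1Dxn R (k * m%:R) 1 km0.
apply: (@le_trans _ _ (a * ((k * m%:R) ^+ 2 / 2))); last first.
  by rewrite ler_wpM2l ?(ltW a0) // (le_trans _ h) // lerDr.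
have ak0 : 0 < a * k ^+ 2 by rewrite mulr_gt0 // exprn_gt0.
move: mA; rewrite ler_pdivrMr // => mA.
have := ler_wpM2r (ler0n R m) mA; lra.
Qed.

Lemma Log_exp_lower (b : R) (m : nat) : expR (ln 2 / 4 * m%:R) <= b ->
  ln 2 / 4 * m%:R <= Log b.
Proof.
move=> hb; have b0 : 0 < b by exact: lt_le_trans (expR_gt0 _) hb.
apply: le_trans (Log_ge_ln b0).
by rewrite -[leLHS]expRK ler_ln ?posrE ?expR_gt0.
Qed.

(** A threshold of at least 2^(m/4) has logarithm of order at least m. The root sqrt m is written as
    an exponential of [lnn m], to be played against the factors e^(ty). *)
Lemma sqrt_Log_lower (b : R) (m : nat) : (0 < m)%N ->
  expR (ln 2 / 4 * m%:R) <= b ->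
  Num.sqrt (ln 2 / 4) * expR (lnn m / 2) <= Num.sqrt (Log b).
Proof.
move=> m0 /Log_exp_lower hb.
have -> : expR (lnn m / 2) = Num.sqrt (m%:R).
  have -> : m%:R = expR (lnn m / 2) ^+ 2.
    by rewrite -expRM_natl mulrC divfK // expR_lnn.
  by rewrite sqrtr_sqr ger0_norm ?expR_ge0.
have ln20 := ln2_gt0.
rewrite -sqrtrM; last by rewrite divr_ge0 // ltW.
by rewrite ler_sqrt // ltW // Log_gt0.
Qed.

(** The threshold has the order of 1/t for the Chernoff parameter t ~ sqrt(l / 2^m), l = ln m. There
    2^m times the tail bound is O(l / sqrt m), which leaves room for the factor m^(1/4) that e^(ty)
    will contribute. *)
Lemma tail_bound_diffusive (H delta : R) : 0 <= H -> 0 < delta ->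
  exists C m0, 0 <= C /\ forall m, (m0 <= m)%N ->
    2 ^+ m * expR (lnn m / 4) * tail_bound H (delta * Num.sqrt (2 ^+ m / lnn m)) <= C.
Proof.
move=> H0 d0.
have [m1 Hm1] := lnn_large 1.
have ln20 := ln2_gt0.
have [m2 Hm2] : exists m2, forall m, (m2 <= m)%N ->
    m%:R <= delta ^+ 2 * expR (ln 2 / 2 * m%:R).
  by apply: linear_le_expR; rewrite ?exprn_gt0 // divr_gt0.
exists (4 * H / (delta ^+ 2 * Num.sqrt (ln 2 / 4))), (maxn 1 (maxn m1 m2)).
have c0 : 0 < Num.sqrt (ln 2 / 4 : R) by rewrite sqrtr_gt0 divr_gt0.
have dd0 : 0 < delta ^+ 2 by rewrite exprn_gt0.
split; first by rewrite divr_ge0 ?mulr_ge0 // ltW.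
move=> m; rewrite !geq_max => /and3P[m0 /Hm1 l1 /Hm2 hm].
have l0 : 0 < lnn m by exact: lt_le_trans l1.
set N : R := 2 ^+ m; have N0 : 0 < N by rewrite exprn_gt0.
have Nl0 : 0 < N / lnn m by rewrite divr_gt0.
set b := delta * _.
have b2 : b ^+ 2 = delta ^+ 2 * (N / lnn m) by rewrite exprMn sqr_sqrtr // ltW.
have b0 : 0 <= b by rewrite mulr_ge0 ?sqrtr_ge0 // ltW.
(* The square of [b] is at least 2^(m/2), since l <= m <= delta^2 2^(m/2) for large m. *)
have hb : expR (ln 2 / 4 * m%:R) <= b.
  rewrite -ler_sqr ?nnegrE ?expR_ge0 // b2 mulrA ler_pdivlMr //.
  rewrite -expRM_natl /N exp2nE.
  have -> : ln 2 * m%:R = 2%:R * (ln 2 / 4 * m%:R) + ln 2 / 2 * m%:R :> R by field.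
  rewrite expRD [leRHS]mulrCA ler_wpM2l ?expR_ge0 //.
  exact: le_trans (lnn_le m) hm.
have sL := sqrt_Log_lower m0 hb.
have e2 : 0 < expR (lnn m / 2) by exact: expR_gt0.
have S0 : 0 < Num.sqrt (Log b) by rewrite sqrtr_gt0 Log_gt0.
rewrite /tail_bound b2.
have -> : N * expR (lnn m / 4) * (H / (delta ^+ 2 * (N / lnn m) * Num.sqrt (Log b)))
  = H / delta ^+ 2 * (lnn m * expR (lnn m / 4) / Num.sqrt (Log b)).
  by field; rewrite !gt_eqF.
have -> : 4 * H / (delta ^+ 2 * Num.sqrt (ln 2 / 4)) =
  H / delta ^+ 2 * (4 / Num.sqrt (ln 2 / 4)).
  by field; rewrite !gt_eqF.
rewrite ler_wpM2l ?divr_ge0 ?(ltW dd0) // ler_pdivrMr // mulrAC ler_pdivlMr //.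
apply: (@le_trans _ _ (4 * (Num.sqrt (ln 2 / 4) * expR (lnn m / 2)))); last first.
  by rewrite ler_wpM2l.
(* Of the two factors e^(l/4) in sqrt m, one cancels the allowance and the other absorbs l, as l <=
   4 e^(l/4). *)
have -> : lnn m / 2 = lnn m / 4 + lnn m / 4 by field.
rewrite expRD [leLHS]mulrC [leRHS]mulrCA ler_wpM2l ?(ltW c0) // mulrA.
rewrite ler_wpM2r ?expR_ge0 //.
have := @expR_ge1Dx R (lnn m / 4); lra.
Qed.

(** The number 2^m / m^2 of terms is exactly the square of the threshold, so only m^(1/4) / sqrt(Log
    b) remains. *)
Lemma tail_bound_subdiffusive (H : R) : 0 <= H ->
  exists C m0, 0 <= C /\ forall m, (m0 <= m)%N ->
    2 ^+ m / m%:R ^+ 2 * expR (lnn m / 4) * tail_bound H (Num.sqrt (2 ^+ m) / m%:R)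
        <= C.
Proof.
move=> H0.
have [m1 Hm1] := lnn_large 1.
have ln20 := ln2_gt0.
have [m2 Hm2] : exists m2, forall m, (m2 <= m)%N ->
    m%:R <= 1 * expR (ln 2 / 4 * m%:R) :> R.
  by apply: linear_le_expR; rewrite // divr_gt0.
exists (H / Num.sqrt (ln 2 / 4)), (maxn 1 (maxn m1 m2)).
have c0 : 0 < Num.sqrt (ln 2 / 4 : R) by rewrite sqrtr_gt0 divr_gt0.
split; first by rewrite divr_ge0 // ltW.
move=> m; rewrite !geq_max => /and3P[m0 /Hm1 l1 /Hm2]; rewrite mul1r => hm.
have l0 : 0 < lnn m by exact: lt_le_trans l1.
have mR : 0 < m%:R :> R by rewrite ltr0n.
set N : R := 2 ^+ m; have N0 : 0 < N by rewrite exprn_gt0.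
have sN : Num.sqrt N = expR (ln 2 / 2 * m%:R).
  rewrite /N exp2nE.
  have -> : ln 2 * m%:R = ln 2 / 2 * m%:R + ln 2 / 2 * m%:R :> R by field.
  by rewrite expRD -expr2 sqrtr_sqr ger0_norm ?expR_ge0.
set b := _ / m%:R.
have b2 : b ^+ 2 = N / m%:R ^+ 2 by rewrite exprMn sqr_sqrtr ?exprVn // ltW.
have hb : expR (ln 2 / 4 * m%:R) <= b.
  rewrite /b sN ler_pdivlMr //.
  have -> : ln 2 / 2 * m%:R = ln 2 / 4 * m%:R + ln 2 / 4 * m%:R :> R by field.
  by rewrite expRD ler_wpM2l ?expR_ge0.
have sL := sqrt_Log_lower m0 hb.
have S0 : 0 < Num.sqrt (Log b) by rewrite sqrtr_gt0 Log_gt0.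
rewrite /tail_bound b2.
have -> : N / m%:R ^+ 2 * expR (lnn m / 4) * (H / (N / m%:R ^+ 2 * Num.sqrt (Log b)))
  = H * (expR (lnn m / 4) / Num.sqrt (Log b)).
  by field; rewrite !gt_eqF.
rewrite ler_wpM2l // ler_pdivrMr // [leRHS]mulrC ler_pdivlMr // [leLHS]mulrC.
apply: le_trans sL; rewrite ler_wpM2l ?(ltW c0) // ler_expR; lra.
Qed.

Lemma card_factor_le (m D : nat) : (0 < m)%N ->
  (m.+1 ^ D)%:R <= 2 ^+ D * expR (D%:R * lnn m) :> R.
Proof.
move=> m0; rewrite expRM_natl expR_lnn // natrX -exprMn lerXn2r ?nnegrE ?mulr_ge0 //.
by rewrite -natrM ler_nat; lia.
Qed.

(** For positive m, 2^(radix m) lies between m^2 / 4 and m^2: the rounding slab is a fraction O(1 /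
    m^2) of the box, while the grid stays polynomial in m. *)
Definition radix (m : nat) : nat := 2 * trunc_log 2 m.

Lemma radix_le m : (0 < m)%N -> (2 ^ radix m <= m ^ 2)%N.
Proof. by move=> m0; rewrite /radix mulnC expnM leq_exp2r // trunc_logP. Qed.

Lemma radix_ge m : (m ^ 2 <= 4 * 2 ^ radix m)%N.
Proof.
have h : (m < 2 ^ (trunc_log 2 m).+1)%N by apply: trunc_log_ltn.
rewrite /radix [(2 * _)%N]mulnC expnM -(expnMn 2 _ 2) leq_exp2r //.
by rewrite -expnS ltnW.
Qed.

Lemma radix_factor_le (m dim : nat) : (0 < m)%N ->
  ((2 ^ (radix m).+1).+1 ^ dim)%:R <= 3 ^+ dim * expR ((2 * dim)%:R * lnn m) :> R.
Proof.
move=> m0; rewrite expRM_natl expR_lnn // exprM natrX -exprMn lerXn2r ?nnegrE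
    ?mulr_ge0 ?exprn_ge0 //.
rewrite -natrX -natrM ler_nat expnS.
have h := radix_le m0; have h' : (0 < m ^ 2)%N by rewrite expn_gt0 m0.
by move: h h'; set a := (2 ^ _)%N; set b := (m ^ 2)%N; lia.
Qed.

Lemma full_factor_le (m dim : nat) :
  ((2 ^ m.+1).+1 ^ dim)%:R <= 3 ^+ dim * expR (dim%:R * m%:R) :> R.
Proof.
rewrite expRM_natl natrX -exprMn lerXn2r ?nnegrE ?mulr_ge0 ?expR_ge0 //.
apply: (@le_trans _ _ (3 * 2 ^+ m)).
  rewrite -natrX -natrM ler_nat expnS.
  have h : (0 < 2 ^ m)%N by rewrite expn_gt0.
  by move: h; set a := (2 ^ _)%N; lia.
rewrite ler_wpM2l // exp2nE ler_expR -[leRHS]mul1r ler_wpM2r //.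
exact: ln2_le1.
Qed.
End asymptotics.

(** * The moment weight against the number of indices *)

Section weights.
Variable R : realType.

Definition moment_weight (D : nat) (x : R) : R :=
  x ^+ 2 * Log `|x| ^+ D / Log (Log `|x|).

Lemma moment_weight_ge0 D x : 0 <= moment_weight D x.
Proof.
rewrite /moment_weight; have L0 y : 0 <= Log y :> R by rewrite ltW // Log_gt0.
by apply: divr_ge0 => //; apply: mulr_ge0; [exact: sqr_ge0|exact: exprn_ge0].
Qed.

Lemma Log_le_id (u : R) : 1 <= u -> Log u <= u.
Proof.
move=> u1; rewrite /Log; case: (leP u (expR 1)) => ue; first by rewrite expRK.
by rewrite ltW // ln_sublinear // (lt_le_trans _ u1).
Qed.

Definition cap (e : R) (m : nat) : R := e * Num.sqrt (2 ^+ m * lnn R m).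

Lemma cap_ge0 e m : 0 <= e -> 0 <= cap e m.
Proof. by move=> e0; rewrite mulr_ge0 ?sqrtr_ge0. Qed.

(** For [D = dim.-1] the left side bounds the number of indices of level at most [m]. Past the cap,
    x^2 exceeds e^2 2^m ln m and Log x is at least of order m; the factor ln m compensates Log (Log
    x) as long as the latter is at most 2 ln m. *)
Lemma level_weight_le (e : R) (D dim : nat) : 0 < e ->
  exists K m0, 0 <= K /\ forall (m : nat) (x : R), (m0 <= m)%N -> cap e m < x ->
    (m.+1 ^ D * 2 ^ (m.+1 + dim))%:R <= K * moment_weight D x.
Proof.
move=> e0; have ln20 := @ln2_gt0 R.
have [m1 Hm1] := lnn_large (1 : R).
have [m2 Hm2] : exists m2, forall m, (m2 <= m)%N ->
    m%:R <= e ^+ 2 * expR (ln 2 / 2 * m%:R) :> R.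
  by apply: linear_le_expR; rewrite ?exprn_gt0 // divr_gt0.
(* The weight is at least [k1] 2^m m^D in the main case; [k0] collects the factors from m + 1 <= 2m
   and from the exponent m + 1 + dim. *)
pose k1 : R := e ^+ 2 / 2 * (ln 2 / 4) ^+ D.
have k10 : 0 < k1 by rewrite mulr_gt0 ?exprn_gt0 // divr_gt0 // exprn_gt0.
pose k0 : R := 2 ^+ D * 2 ^+ dim.+1.
have k00 : 0 <= k0 by rewrite mulr_ge0 // exprn_ge0.
exists (k0 / k1 + k0), (maxn 1 (maxn m1 m2)).
have k2 : 0 <= k0 / k1 by rewrite divr_ge0 // ltW.
split; first by rewrite addr_ge0.
move=> m x; rewrite !geq_max => /and3P[m0 /Hm1 l1 /Hm2 hm] yx.
have l0 : 0 < lnn R m by exact: lt_le_trans l1.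
have mR : 1 <= m%:R :> R by rewrite (ler_nat _ 1%N).
have y0 : 0 <= cap e m by exact/cap_ge0/ltW.
have x0 : 0 < x by exact: le_lt_trans yx.
set N : R := 2 ^+ m; have N0 : 0 < N by rewrite exprn_gt0.
have w0 : (m.+1 ^ D * 2 ^ (m.+1 + dim))%:R <= k0 * (N * m%:R ^+ D).
  rewrite natrM addSnnS expnD natrM !natrX.
  have -> : k0 * (N * m%:R ^+ D) = (2 * m%:R) ^+ D * (N * 2 ^+ dim.+1).
    by rewrite /k0 exprMn; ring.
  rewrite ler_wpM2r ?mulr_ge0 ?exprn_ge0 //.
  rewrite lerXn2r ?nnegrE ?mulr_ge0 // -natr1; lra.
have phi0 := moment_weight_ge0 D x.
rewrite mulrDl; apply: le_trans w0 _.
have yx2 : cap e m ^+ 2 < x ^+ 2 by rewrite ltr_sqr ?nnegrE // ltW.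
have yE : cap e m ^+ 2 = e ^+ 2 * (N * lnn R m).
  by rewrite exprMn sqr_sqrtr // mulr_ge0 // ltW.
have LL0 : 0 < Log (Log x) by exact: Log_gt0.
have xE : `|x| = x by rewrite gtr0_norm.
(* If [log log x > 2 ln m] then [log x > m ^ 2], and [x] alone beats [2 ^ m]. *)
case: (leP (Log (Log x)) (2 * lnn R m)) => [LLl|LLl].
  apply: (@le_trans _ _ (k0 / k1 * moment_weight D x)); last first.
    by rewrite lerDl mulr_ge0.
  rewrite -[leRHS]mulrA ler_wpM2l // [leRHS]mulrC ler_pdivlMr //.
  rewrite /moment_weight xE /k1.
  have LX : ln 2 / 4 * m%:R <= Log x.
    apply: Log_exp_lower; apply: le_trans (ltW yx).
    rewrite -ler_sqr ?nnegrE ?expR_ge0 // yE -expRM_natl /N exp2nE.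
    have -> : 2%:R * (ln 2 / 4 * m%:R) = ln 2 / 2 * m%:R :> R by field.
    have -> : ln 2 * m%:R = ln 2 / 2 * m%:R + ln 2 / 2 * m%:R :> R by field.
    set E := expR (ln 2 / 2 * m%:R) in hm *.
    rewrite expRD -/E -[leLHS]mulr1.
    have E0 : 0 < E by exact: expR_gt0.
    have -> : e ^+ 2 * (E * E * lnn R m) = E * (e ^+ 2 * E * lnn R m) by ring.
    rewrite ler_wpM2l ?(ltW E0) //; nra.
  apply: (@le_trans _ _ ((x ^+ 2 / Log (Log x)) * (ln 2 / 4 * m%:R) ^+ D)); last first.
    rewrite mulrAC ler_wpM2r ?invr_ge0 ?(ltW LL0) // ler_wpM2l ?sqr_ge0 //.
    by rewrite lerXn2r ?nnegrE // ?(le_trans _ LX) // ?mulr_ge0 ?divr_ge0 // ltW.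
  rewrite [(ln 2 / 4 * m%:R) ^+ D]exprMn.
  have -> : N * m%:R ^+ D * (e ^+ 2 / 2 * (ln 2 / 4) ^+ D) =
     (e ^+ 2 / 2 * N) * ((ln 2 / 4) ^+ D * m%:R ^+ D) by ring.
  rewrite ler_wpM2r ?mulr_ge0 ?exprn_ge0 ?divr_ge0 ?(ltW ln20) //.
  rewrite ler_pdivlMr //; apply: le_trans (ltW yx2); rewrite yE.
  have eN : 0 <= e ^+ 2 / 2 * N by rewrite mulr_ge0 ?divr_ge0 ?sqr_ge0 // ltW.
  have := ler_wpM2l eN LLl; lra.
apply: (@le_trans _ _ (k0 * moment_weight D x)); last by rewrite lerDr mulr_ge0.
rewrite ler_wpM2l // /moment_weight xE.
have L1 := Log_ge1 x.
have hL : m%:R ^+ 2 <= Log x.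
  have : 2 * lnn R m < ln (Num.max (Log x) (expR 1)) by [].
  case: (leP (Log x) (expR 1)) => h; first by rewrite expRK; lra.
  rewrite -(expR_lnn R m0) -expRM_natl => h2.
  rewrite -[leRHS](@lnK R) ?posrE ?(lt_le_trans _ L1) // ler_expR ltW //.
have L2 : m%:R <= Log x by apply: le_trans hL; rewrite expr2; nra.
case: (ltrP 1 (Log x)) => [L1'|]; last first.
  move=> L1'; have L11 : Log x = 1 by apply/eqP; rewrite eq_le L1' L1.
  move: LLl; rewrite L11 /Log; have -> : Num.max 1 (expR 1) = expR 1 :> R.
    by apply/max_idPr; rewrite -[leLHS]expR0 ler_expR.
  by rewrite expRK; lra.
have xe : expR 1 < x.
  rewrite ltNge; apply/negP => h; move: L1'; rewrite /Log.
  by rewrite (max_idPr h) expRK ltxx.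
have x1 : 1 <= x by rewrite (le_trans _ (ltW xe)) // -[leLHS]expR0 ler_expR.
have Lx : Log x = ln x by rewrite /Log (max_idPl (ltW xe)).
have LLx : Log (Log x) <= x.
  exact: le_trans (Log_le_id L1) (Log_le_id x1).
have Nx : N <= x.
  rewrite /N exp2nE -[leRHS](@lnK R) ?posrE // -Lx ler_expR.
  apply: le_trans L2; rewrite -[leRHS]mul1r ler_wpM2r //; exact: ln2_le1.
(* Here x^2 / Log (Log x) >= x >= 2^m, and (Log x)^D >= m^D. *)
rewrite mulrAC; apply: ler_pM => //; first exact: ltW.
- by rewrite (le_trans Nx) // ler_pdivlMr // expr2 ler_wpM2l // ltW.
- by rewrite lerXn2r ?nnegrE // (le_trans _ L1).
Qed.
End weights.

(** * Summability of the exceedances of the cap *)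

Section exceedance.
Context d (T : measurableType d) (R : realType) (P : probability T R).
Variable Y : T -> R.
Hypothesis mY : measurable_fun setT Y.

Lemma measurable_moment_weight D : measurable_fun setT (@moment_weight R D).
Proof.
have mL : measurable_fun setT (fun x : R => Log `|x|).
  exact: measurableT_comp (@measurable_Log R) (@normr_measurable R setT).
apply: measurable_funM.
  by apply: measurable_funM; exact: measurable_funX.
(* Since Log is at least 1, the maximum with 1 changes nothing and turns the inverse into a
   monotone, hence measurable, function. *)
have -> : (fun x : R => (Log (Log `|x|))^-1) =
    (fun y : R => (Num.max y 1)^-1) \o (fun x : R => Log (Log `|x|)).
  by apply/funext => x /=; rewrite (max_idPl (Log_ge1 _)).
apply: measurableT_comp; last exact: measurableT_comp (@measurable_Log R) mL.
apply: nonincreasing_measurable => //.  move=> x y xy.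
have m0 z : 0 < Num.max z 1 :> R by rewrite lt_max ltr01 orbT.
by rewrite lef_pV2 ?posrE // ge_max !le_max xy lexx orbT.
Qed.

Lemma moment_sqrt_le (D : nat) (M : R) : (0 < D)%N ->
  (\int[P]_w (moment_weight D (Y w))%:E <= M%:E)%E ->
  (\int[P]_w (Y w ^+ 2 * Num.sqrt (Log `|Y w|))%:E <= (2 * M)%:E)%E.
Proof.
move=> D0 HM.
have mphi : measurable_fun setT (fun w => moment_weight D (Y w)).
  exact: measurableT_comp (measurable_moment_weight D) mY.
apply: (@le_trans _ _ (2%:E * \int[P]_w (moment_weight D (Y w))%:E)%E); last first.
  by rewrite EFinM; apply: lee_wpmul2l.
rewrite -(ge0_integralZl P measurableT); last 3 first.
- exact/measurable_EFinP.
- by move=> w _; rewrite lee_fin moment_weight_ge0.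
- by rewrite lee_fin.
apply: (@ge0_le_integral _ _ _ P _ measurableT).
- by move=> w _; rewrite lee_fin mulr_ge0 ?sqr_ge0 ?sqrtr_ge0.
- apply/measurable_EFinP; apply: measurable_funM; first exact: measurable_funX.
  apply: (measurableT_comp (@measurable_sqrtr R)).
  apply: (measurableT_comp (@measurable_Log R)).
  exact: measurableT_comp (@normr_measurable R setT) mY.
- by apply/measurable_EFinP; exact: measurable_funM.
- by move=> w _; rewrite -EFinM lee_fin; exact: moment_weight_ge.
Qed.

(** Sum and expectation are exchanged. Pointwise, the weights of the levels whose cap is exceeded
    grow geometrically, so their sum is at most twice the last one, which [level_weight_le] bounds
    by the moment weight of Y. *)
Lemma sum_level_exceedance_le (e M : R) (D dim : nat) : 0 < e ->
  (\int[P]_w (moment_weight D (Y w))%:E <= M%:E)%E ->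
  exists B m0, forall n, \sum_(m0 <= m < n)
    (m.+1 ^ D * 2 ^ (m.+1 + dim))%:R * fine (P [set w | (cap e m < Y w)%R]) <= B.
Proof.
move=> e0 HM; have [K [m0 [K0 HK]]] := level_weight_le D dim e0.
pose wt m : R := (m.+1 ^ D * 2 ^ (m.+1 + dim))%:R.
have wt0 m : 0 <= wt m by exact: ler0n.
have wt2 n : \sum_(m0 <= m < n.+1) wt m <= 2 * wt n.
  elim: n => [|n IH].
    case: (m0) => [|k]; last by rewrite big_geq // mulr_ge0.
    rewrite big_nat1; have := wt0 0%N; lra.
  case: (leqP m0 n.+1) => h; last by rewrite big_geq // mulr_ge0.
  rewrite big_nat_recr //=.
  suff : 2 * wt n <= wt n.+1 by lra.
  rewrite /wt -natrM ler_nat mulnCA -expnS -addSn.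
  by rewrite leq_mul2r; apply/orP; right; case: (D) => // D'; rewrite leq_exp2r.
have pt n w : \sum_(m0 <= m < n) wt m * \1_[set w | cap e m < Y w] w <=
    2 * K * moment_weight D (Y w).
  have phi0 : 0 <= 2 * K * moment_weight D (Y w).
    by rewrite mulr_ge0 ?moment_weight_ge0 // mulr_ge0.
  elim: n => [|n IH]; first by rewrite big_geq.
  case: (leqP m0 n) => h; last by rewrite big_geq.
  case: (boolP (cap e n < Y w)) => yw.
    apply: (@le_trans _ _ (\sum_(m0 <= m < n.+1) wt m)).
      apply: ler_sum => m _; rewrite -[leRHS]mulr1; apply: ler_wpM2l => //; rewrite
          indicE lern1 leq_b1.
    apply: (le_trans (wt2 n)); rewrite -mulrA ler_wpM2l //; exact: HK.
  rewrite big_nat_recr //= indicE memNset ?mulr0 ?addr0 //.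
  exact/negP.
exists (2 * K * M), m0 => n.
have mA m : measurable [set w | cap e m < Y w] by exact: measurable_gt_preimage.
have PA m : P [set w | cap e m < Y w] = (\int[P]_w (\1_[set w | cap e m < Y w] w)%:E)%E.
  by rewrite (integral_indic P measurableT (mA m)) setIT.
rewrite -lee_fin -sumEFin.
have -> : (\sum_(m0 <= m < n) (wt m * fine (P [set w | (cap e m < Y w)%R]))%:E =
    \int[P]_w (\sum_(m0 <= m < n) (wt m * \1_[set w | (cap e m < Y w)%R] w)%:E))%E.
  rewrite (ge0_integral_sum P measurableT); last 2 first.
  - move=> m; apply/measurable_EFinP; exact: measurable_funM.
  - by move=> m w _; rewrite lee_fin mulr_ge0.
  apply: eq_bigr => m _; rewrite EFinM fineK ?fin_num_measure // PA.
  rewrite -(ge0_integralZl P measurableT) //.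
  - by apply/measurable_EFinP.
  - by rewrite lee_fin.
have -> : (2 * K * M)%:E = ((2 * K)%:E * M%:E)%E by rewrite EFinM.
have mphi : measurable_fun setT (fun w => moment_weight D (Y w)).
  exact: measurableT_comp (measurable_moment_weight D) mY.
apply: (@le_trans _ _ ((2 * K)%:E * \int[P]_w (moment_weight D (Y w))%:E)%E); last
    first.
  by apply: lee_wpmul2l => //; rewrite lee_fin mulr_ge0.
rewrite -(ge0_integralZl P measurableT); last 3 first.
- exact/measurable_EFinP.
- by move=> w _; rewrite lee_fin moment_weight_ge0.
- by rewrite lee_fin mulr_ge0.
apply: (@ge0_le_integral _ _ _ P _ measurableT).
- by move=> w _; apply: sume_ge0 => m _; rewrite lee_fin mulr_ge0.
- apply: emeasurable_sum => m; apply/measurable_EFinP; exact: measurable_funM.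
- by apply/measurable_EFinP; exact: measurable_funM.
- by move=> w _; rewrite sumEFin -EFinM lee_fin.
Qed.
End exceedance.

(** * Almost sure bounds along the levels *)

Section level_events.
Context d (T : measurableType d) (R : realType) (P : probability T R).
Variables (dim : nat) (X : mindex dim -> T -> R).
Hypothesis mX : forall n, mpos n -> measurable_fun setT (X n).
Hypothesis naX : neg_assoc P (fun n => mpos n) X.
Hypothesis idX : forall n, mpos n -> forall B : set R, measurable B ->
  P (X n @^-1` B) = P (X (mone dim) @^-1` B).
Let Y := X (mone dim).
Variables s2 H : R.
Hypothesis s20 : 0 <= s2.
Hypothesis H0 : 0 <= H.
Hypothesis iY : P.-integrable setT (EFin \o Y).
Hypothesis EY : (\int[P]_w (Y w)%:E = 0)%E.
Hypothesis EY2 : (\int[P]_w (Y w ^+ 2)%:E <= s2%:E)%E.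
Hypothesis EYH : (\int[P]_w (Y w ^+ 2 * Num.sqrt (Log `|Y w|))%:E <= H%:E)%E.

Let mY : measurable_fun setT Y.
Proof. by apply: mX; exact: mpos_mone. Qed.

Lemma measurable_sum_ge (f : R -> R) (x : R) (s : seq (mindex dim)) :
  measurable_fun setT f -> all (@mpos dim) s ->
  measurable [set w | x <= \sum_(i <- s) f (X i w)].
Proof.
move=> mf ps; apply: measurable_ge_preimage; exact: (measurable_fun_sum mX mf ps).
Qed.

Lemma scaled_chernoff (f : R -> R) (M t v x : R) (s : seq (mindex dim)) :
  {homo f : a b / a <= b} -> (forall a, f a <= M) -> 0 <= t ->
  uniq s -> all (@mpos dim) s ->
  (\int[P]_w (expR (t * f (Y w)))%:E <= (expR v)%:E)%E ->
  (P [set w | (x <= \sum_(i <- s) f (X i w))%R] <=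
     (expR (- (t * x) + (size s)%:R * v))%:E)%E.
Proof.
move=> fnd fM t0 us ps hv.
have mf : measurable_fun setT f.
  by apply: nondecreasing_measurable => // a b _ _; exact: fnd.
have gnd : {homo (fun a => t * f a) : a b / a <= b}.
  by move=> a b ab; rewrite ler_wpM2l // fnd.
apply: le_trans (@neg_assoc_chernoff _ T R P dim X mX naX idX (fun a => t * f a)
  (t * M) v (t * x) s gnd _ us ps hv); last by move=> a; rewrite ler_wpM2l.
apply: le_measure; rewrite ?inE.
- exact: measurable_sum_ge.
- apply: (@measurable_sum_ge (fun a => t * f a)) => //.
  exact: measurable_funM.
- by move=> w /= xw; rewrite -mulr_sumr ler_wpM2l.
Qed.

Lemma truncated_sum_tail (t b y x : R) (s : seq (mindex dim)) :
  0 <= t -> 0 < b -> uniq s -> all (@mpos dim) s ->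
  (P [set w | (x <= \sum_(i <- s) Num.min (X i w) y)%R] <=
   (expR (- (t * x) + (size s)%:R * (t ^+ 2 * s2 / 2 * expR (t * b) +
     expR (t * y) * tail_bound H b)))%:E)%E.
Proof.
move=> t0 b0 us ps.
apply: (@scaled_chernoff (fun a => Num.min a y) y) => //.
- by move=> a c ac; rewrite le_min !ge_min ac lexx orbT.
- by move=> a; rewrite ge_min lexx orbT.
- apply: mgf_min_le => //; first exact: ltW.
  exact: tail_le.
Qed.

Lemma excess_sum_tail (t c y x : R) (s : seq (mindex dim)) :
  0 <= t -> 0 < c -> 0 <= y -> uniq s -> all (@mpos dim) s ->
  (P [set w | (x <= \sum_(i <- s) Num.min (Num.max (X i w - c) 0) y)%R] <=
   (expR (- (t * x) + (size s)%:R * (expR (t * y) * tail_bound H c)))%:E)%E.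
Proof.
move=> t0 c0 y0 us ps.
apply: (@scaled_chernoff (fun a => Num.min (Num.max (a - c) 0) y) y) => //.
- move=> a b ab; rewrite le_min ge_min ge_min lexx orbT andbT.
  by rewrite ge_max !le_max lerD2r ab lexx !orbT.
- by move=> a; rewrite ge_min lexx orbT.
- by apply: mgf_excess_le => //; exact: tail_le.
Qed.

(** The event attached to [n] depends on [n] only through its level and its two roundings, so a
    union over keys and Borel-Cantelli over levels suffice. The number of digits [q m] may vary with
    the level. *)
Lemma ae_level (q : nat -> nat) (E : nat -> mindex dim -> mindex dim -> set T)
    (u : nat -> R) (K rho : R) m0 : 0 <= K -> 0 < rho ->
  (forall m, (m0 <= m)%N -> 0 <= u m) ->
  (forall m, (m0 <= m)%N ->
     (m.+1 ^ dim.-1)%:R * ((2 ^ (q m).+1).+1 ^ dim)%:R * u m <=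
       K * expR (- (1 + rho) * lnn R m)) ->
  (forall m n, (m0 <= m)%N -> mpos n -> mlevel n = m ->
     let A := E m (mround (q m) n) (mceil (q m) n) in
     measurable A /\ (P A <= (u m)%:E)%E) ->
  {ae P, forall w, exists M, forall n : mindex dim, (M <= mlevel n)%N -> mpos n ->
     ~ E (mlevel n) (mround (q (mlevel n)) n) (mceil (q (mlevel n)) n) w}.
Proof.
move=> K0 rho0 u0 Ku HE.
pose B m := [set w | exists n, [/\ mpos n, mlevel n = m &
  E m (mround (q m) n) (mceil (q m) n) w]].
have : {ae P, forall w, exists M : nat, forall m, (M <= m)%N -> ~ B m w}.
  apply: (@borel_cantelli_power _ T R P B K rho m0) => // m m0m.
  have [F [mF EF PF]] : exists F, [/\ measurable F,
      forall n, mpos n /\ mlevel n = m ->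
        E m (mround (q m) n) (mceil (q m) n) `<=` F &
      (P F <= (#|{: {ffun 'I_dim.-1 -> 'I_m.+1} *
                   {ffun 'I_dim -> 'I_(2 ^ (q m).+1).+1}}|%:R * u m)%:E)%E].
    apply: (@finite_union_bound _ T R P _ (mindex dim) (mkey m (q m))) => //.
    - exact: u0.
    - by move=> n n' [pn nm] [pn' nm'] /(mkey_inj nm nm')[-> ->].
    - by move=> n [pn nm]; exact: HE.
  exists F; split => //.
    by move=> w [n [pn nm En]]; exact: (EF n (conj pn nm) w En).
  apply: (le_trans PF); rewrite lee_fin card_mkey natrM; exact: Ku.
apply: filterS => w [M HM]; exists M => n Mn pn En.
by apply: (HM _ Mn); exists n.
Qed.

Lemma msize_bounds (n : mindex dim) : mpos n ->
  (2 ^+ mlevel n <= (msize n)%:R :> R) /\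
  ((msize n)%:R <= 2 ^+ dim * 2 ^+ mlevel n :> R).
Proof.
move=> pn; split; first by rewrite -natrX ler_nat expn_mlevel_le.
by rewrite -!natrX -natrM ler_nat -expnD addnC msize_le.
Qed.

Lemma sum_ge_bound (f : R -> R) (b : R) (s : seq (mindex dim)) (w : T) :
  ~ (b <= \sum_(i <- s) f (X i w)) -> \sum_(i <- s) f (X i w) <= b.
Proof. by move/negP; rewrite -ltNge => /ltW. Qed.

Lemma ae_grid_bound (q : nat) (s : R) : (0 < dim)%N -> 0 < s -> s2 < s ^+ 2 ->
  exists2 e0, 0 < e0 & forall e, 0 < e <= e0 ->
  {ae P, forall w, exists M, forall n : mindex dim, (M <= mlevel n)%N -> mpos n ->
    \sum_(i <- mbox (mround q n)) Num.min (X i w) (cap e (mlevel n)) <=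
    s * Num.sqrt (2 * dim%:R * (msize (mround q n))%:R * lnn R (mlevel n))}.
Proof.
move=> dim0 s0 s2s.
have dR : 0 < dim%:R :> R by rewrite ltr0n.
have ss0 : 0 < s ^+ 2 by rewrite exprn_gt0.
pose th := s2 / s ^+ 2; have th1 : th < 1 by rewrite /th ltr_pdivrMr // mul1r.
have th0 : 0 <= th by rewrite /th divr_ge0 // ltW.
pose ka := (1 + th) / 2; have ka1 : ka < 1 by rewrite /ka; lra.
have ka0 : 0 < ka by rewrite /ka; lra.
(* [u] will bound [t * b]: it keeps the inflated variance ratio below [ka < 1]. *)
pose u := 1 - th / ka.
have u0 : 0 < u by rewrite /u subr_gt0 ltr_pdivrMr // mul1r /ka; lra.
have thu : th * expR u <= ka.
  have h : th / ka <= expR (- u) by rewrite -[leLHS](subKr 1) expR_ge1Dx.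
  have : th / ka * expR u <= 1.
    by rewrite -(mulVf (lt0r_neq0 (expR_gt0 u))) -expRN ler_wpM2r ?expR_ge0.
  by rewrite mulrAC ler_pdivrMr // mul1r.
have sd0 : 0 < Num.sqrt (2 * dim%:R : R) by rewrite sqrtr_gt0 mulr_gt0.
(* Makes t * b at most [u], because the box has at least 2^m elements. *)
pose de := u * s / Num.sqrt (2 * dim%:R).
have de0 : 0 < de by rewrite divr_gt0 // mulr_gt0.
have [C [m1 [C0 HC]]] := tail_bound_diffusive H0 de0.
have [m2 Hm2] := lnn_large (1 : R).
(* Makes t * cap at most l / 4, the allowance of [tail_bound_diffusive]. *)
exists (s / (4 * Num.sqrt (2 * dim%:R))); first by rewrite divr_gt0 // mulr_gt0.
move=> e /andP[e0 ee0].
pose up m := expR (- (2 * dim%:R - dim%:R * ka) * lnn R m + 2 ^+ dim * C) : R.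
have HA := @ae_level (fun=> q) (fun m p _ => [set w | s * Num.sqrt (2 * dim%:R *
    (msize p)%:R * lnn R m)
    <= \sum_(i <- mbox p) Num.min (X i w) (cap e m)]) up
  (2 ^+ dim.-1 * ((2 ^ q.+1).+1 ^ dim)%:R * expR (2 ^+ dim * C)) (dim%:R * (1 - ka))
  (maxn 1 (maxn m1 m2)).
have {HA} : {ae P, forall w, exists M, forall n : mindex dim, (M <= mlevel n)%N ->
    mpos n ->
   ~ (s * Num.sqrt (2 * dim%:R * (msize (mround q n))%:R * lnn R (mlevel n))
    <= \sum_(i <- mbox (mround q n)) Num.min (X i w) (cap e (mlevel n)))}.
  apply: HA.
  - by rewrite !mulr_ge0 ?exprn_ge0 ?expR_ge0.
  - by rewrite mulr_gt0 // subr_gt0.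
  - by move=> m _; exact: expR_ge0.
  - move=> m; rewrite !geq_max => /and3P[m0 _ _].
    rewrite /up expRD.
    set A := ((2 ^ q.+1).+1 ^ dim)%:R; set B := expR (2 ^+ dim * C).
    have h := @card_factor_le R m dim.-1 m0.
    have AB0 : 0 <= A * B by rewrite mulr_ge0 ?expR_ge0.
    have -> : (m.+1 ^ dim.-1)%:R * A * (expR (- (2 * dim%:R - dim%:R * ka) * lnn R m)
        * B) =
      (A * B * expR (- (2 * dim%:R - dim%:R * ka) * lnn R m)) * (m.+1 ^ dim.-1)%:R by
          ring.
    apply: le_trans (ler_wpM2l _ h) _; first by rewrite mulr_ge0 ?expR_ge0.
    rewrite le_eqVlt; apply/orP; left; apply/eqP.
    have dE : dim%:R = 1 + dim.-1%:R :> R by rewrite -{1}(prednK dim0) -nat1r.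
    have -> : - (1 + dim%:R * (1 - ka)) * lnn R m = - (2 * dim%:R - dim%:R * ka) *
        lnn R m
      + dim.-1%:R * lnn R m by rewrite dE; ring.
    by rewrite expRD; ring.
  - move=> m n; rewrite !geq_max => /and3P[m0 /HC{}HC /Hm2 l1] pn nm /=.
    set p := mround q n; have pp : mpos p by exact: mpos_mround.
    have pm : mlevel p = m by rewrite mlevel_mround.
    split; first by apply: (@measurable_sum_ge (fun a => Num.min a _)) => //;
      [exact: measurable_minr | exact: mbox_pos].
    have [] := msize_bounds pp; rewrite pm.
    set N : R := 2 ^+ m in HC *; set a : R := (msize p)%:R => Na aN.
    have N0 : 0 < N by rewrite exprn_gt0.
    have a0 : 0 < a by exact: lt_le_trans Na.
    have l0 : 0 < lnn R m by exact: lt_le_trans l1.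
    have l0' := ltW l0.
    (* The minimiser of - t x + a t^2 s^2 / 2 for x = s sqrt(2 d a l). *)
    pose t := Num.sqrt (2 * dim%:R * lnn R m / a) / s.
    have dl0 : 0 <= 2 * dim%:R * lnn R m by rewrite !mulr_ge0 // ltW.
    have t0 : 0 <= t by rewrite divr_ge0 ?sqrtr_ge0 // ltW.
    have b0 : 0 < de * Num.sqrt (N / lnn R m) by rewrite mulr_gt0 // sqrtr_gt0 divr_gt0.
    apply: (le_trans (truncated_sum_tail (cap e m) _ t0 b0 (mbox_uniq p) (mbox_pos p))).
    rewrite lee_fin ler_expR size_mbox -/a.
    have tx : t * (s * Num.sqrt (2 * dim%:R * a * lnn R m)) = 2 * dim%:R * lnn R m.
      rewrite /t mulrA divfK ?gt_eqF // -sqrtrM ?divr_ge0 // ?(ltW a0) //.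
      have -> : 2 * dim%:R * lnn R m / a * (2 * dim%:R * a * lnn R m) =
        (2 * dim%:R * lnn R m) ^+ 2 by field; rewrite gt_eqF.
      by rewrite sqrtr_sqr ger0_norm.
    have at2 : a * (t ^+ 2 * s2 / 2) = dim%:R * lnn R m * th.
      rewrite /t exprMn sqr_sqrtr ?divr_ge0 ?(ltW a0) // exprVn /th.
      by field; rewrite !gt_eqF.
    have tb : t * (de * Num.sqrt (N / lnn R m)) <= u.
      have -> : t * (de * Num.sqrt (N / lnn R m)) =
        u * (Num.sqrt (2 * dim%:R * lnn R m / a) * Num.sqrt (N / lnn R m) / Num.sqrt
            (2 * dim%:R)).
        by rewrite /t /de; field; rewrite !gt_eqF.
      rewrite -[leRHS]mulr1 ler_wpM2l ?(ltW u0) // ler_pdivrMr // mul1r.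
      rewrite -sqrtrM ?divr_ge0 ?(ltW a0) // ler_sqrt ?mulr_ge0 //.
      have -> : 2 * dim%:R * lnn R m / a * (N / lnn R m) = 2 * dim%:R * (N / a).
        by field; rewrite !gt_eqF.
      by rewrite -[leRHS]mulr1 ler_wpM2l ?mulr_ge0 // ler_pdivrMr // mul1r.
    have ty : t * cap e m <= lnn R m / 4.
      have -> : t * cap e m = e / s * (Num.sqrt (2 * dim%:R * lnn R m / a) * Num.sqrt
          (N * lnn R m)).
        by rewrite /t /cap; field; rewrite !gt_eqF.
      have : Num.sqrt (2 * dim%:R * lnn R m / a) * Num.sqrt (N * lnn R m) <= Num.sqrt
          (2 * dim%:R) * lnn R m.
        rewrite -[in leRHS](gtr0_norm l0) -sqrtr_sqr -!sqrtrM ?divr_ge0 ?(ltW a0)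
            ?mulr_ge0 //.
        rewrite ler_sqrt ?mulr_ge0 ?sqr_ge0 //.
        have -> : 2 * dim%:R * lnn R m / a * (N * lnn R m) = (2 * dim%:R * lnn R m ^+
            2) * (N / a).
          by field; rewrite !gt_eqF.
        rewrite -[leRHS]mulr1; apply: ler_wpM2l.
          by apply: mulr_ge0; [rewrite mulr_ge0|exact: sqr_ge0].
        by rewrite ler_pdivrMr // mul1r.
      move=> h; have es0 : 0 <= e / s by rewrite divr_ge0 // ltW.
      apply: le_trans (ler_wpM2l es0 h) _.
      move: ee0; rewrite ler_pdivlMr ?mulr_gt0 // => ee0.
      rewrite mulrAC ler_pdivrMr //; have := ler_wpM2r (ltW l0) ee0; lra.
    rewrite tx mulrDr.
    have h1 : a * (t ^+ 2 * s2 / 2 * expR (t * (de * Num.sqrt (N / lnn R m)))) <=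
        dim%:R * lnn R m * ka.
      rewrite mulrA at2 -mulrA ler_wpM2l ?mulr_ge0 ?(ltW l0) //.
      apply: le_trans thu; rewrite ler_wpM2l // ler_expR //.
    have h2 : a * (expR (t * cap e m) * tail_bound H (de * Num.sqrt (N / lnn R m))) <=
        2 ^+ dim * C.
      have tb0 := tail_bound_ge0 (de * Num.sqrt (N / lnn R m)) H0.
      apply: (@le_trans _ _ (2 ^+ dim * N * (expR (lnn R m / 4) * tail_bound H (de *
          Num.sqrt (N / lnn R m))))).
        apply: ler_pM; [exact: ltW | by rewrite mulr_ge0 ?expR_ge0 | exact: aN |].
        by rewrite ler_wpM2r // ler_expR.
      by rewrite -mulrA ler_wpM2l ?exprn_ge0 // mulrA.
    by lra.
apply: filterS => w [M HM]; exists M => n Mn pn.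
exact: (@sum_ge_bound (fun a => Num.min a _) _ _ _ (HM n Mn pn)).
Qed.

(** With [radix m] digits there are O(m^(d-1) m^(2d)) keys, so a probability of order m^(-3d-1) per
    event leaves the summable m^(-2). *)
Lemma ae_radix_level (E : nat -> mindex dim -> mindex dim -> set T) (C : R) m0 :
  (0 < dim)%N ->
  (forall m n, (m0 <= m)%N -> mpos n -> mlevel n = m ->
     let A := E m (mround (radix m) n) (mceil (radix m) n) in
     measurable A /\ (P A <= (expR (- (3 * dim%:R + 1) * lnn R m + C))%:E)%E) ->
  {ae P, forall w, exists M, forall n : mindex dim, (M <= mlevel n)%N -> mpos n ->
     ~ E (mlevel n) (mround (radix (mlevel n)) n) (mceil (radix (mlevel n)) n) w}.
Proof.
move=> dim0 HE.
apply: (@ae_level radix E (fun m => expR (- (3 * dim%:R + 1) * lnn R m + C))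
  (2 ^+ dim.-1 * 3 ^+ dim * expR C) 1 (maxn 1 m0)).
- by rewrite !mulr_ge0 ?exprn_ge0 ?expR_ge0.
- exact: ltr01.
- by move=> m _; exact: expR_ge0.
- move=> m; rewrite geq_max => /andP[m1 _]; rewrite expRD.
  have h1 := @card_factor_le R m dim.-1 m1.
  have h2 := @radix_factor_le R m dim m1.
  rewrite mulrA; set B := expR C; have B0 : 0 <= B by exact: expR_ge0.
  set G := expR (- (3 * dim%:R + 1) * lnn R m); have G0 : 0 <= G by exact: expR_ge0.
  apply: (@le_trans _ _ ((2 ^+ dim.-1 * expR (dim.-1%:R * lnn R m)) *
    (3 ^+ dim * expR ((2 * dim)%:R * lnn R m)) * G * B)).
    by do 2 (apply: ler_wpM2r => //); apply: ler_pM.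
  have -> : - (1 + 1) * lnn R m = dim.-1%:R * lnn R m + (2 * dim)%:R * lnn R m +
      - (3 * dim%:R + 1) * lnn R m.
    have dE : dim%:R = 1 + dim.-1%:R :> R by rewrite -{1}(prednK dim0) -nat1r.
    by rewrite natrM dE; ring.
  rewrite 2!expRD -/G le_eqVlt; apply/orP; left; apply/eqP; ring.
- by move=> m n; rewrite geq_max => /andP[_]; exact: HE.
Qed.

(** Values of t x, t^2, t y and t b at the common Chernoff scale. The last stays [la / la] because
    [la] may be 0 here. *)
Lemma scaling_identities (la eps e : R) m : 0 < lnn R m ->
  let t := la * Num.sqrt (lnn R m / 2 ^+ m) in
  [/\ t * (eps * Num.sqrt (2 ^+ m * lnn R m)) = la * eps * lnn R m,
      t ^+ 2 = la ^+ 2 * (lnn R m / 2 ^+ m),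
      t * cap e m = la * e * lnn R m &
      t * (la^-1 * Num.sqrt (2 ^+ m / lnn R m)) = la / la].
Proof.
move=> l0 t; set N : R := 2 ^+ m; have N0 : 0 < N by rewrite exprn_gt0.
have lN : 0 <= lnn R m / N by rewrite divr_ge0 // ltW.
have k1 : Num.sqrt (lnn R m / N) * Num.sqrt (N * lnn R m) = lnn R m.
  rewrite -sqrtrM //; have -> : lnn R m / N * (N * lnn R m) = lnn R m ^+ 2.
    by field; rewrite gt_eqF.
  by rewrite sqrtr_sqr gtr0_norm.
have k2 : Num.sqrt (lnn R m / N) * Num.sqrt (N / lnn R m) = 1.
  rewrite -sqrtrM //; have -> : lnn R m / N * (N / lnn R m) = 1.
    by field; rewrite !gt_eqF.
  by rewrite sqrtr1.
split; rewrite /t /cap -/N.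
- by rewrite mulrACA k1.
- by rewrite exprMn sqr_sqrtr.
- by rewrite mulrACA k1.
- by rewrite mulrACA k2 mulr1.
Qed.

(** The slab is a fraction O(2^-q) of the box, so a large fixed [q] makes the variance term at most
    l. The choice of [la] gives t x = (3d + 2) l, and the total exponent is - (3d + 1) l + O(1). *)
Lemma ae_increment_bound (eps : R) : (0 < dim)%N -> 0 < eps ->
  exists q e0, 0 < e0 /\ forall e, 0 < e <= e0 ->
  {ae P, forall w, exists M, forall n : mindex dim, (M <= mlevel n)%N -> mpos n ->
    let p := mround (radix (mlevel n)) n in
    \sum_(i <- mslab (mround q p) p) Num.min (X i w) (cap e (mlevel n)) <=
    eps * Num.sqrt (2 ^+ mlevel n * lnn R (mlevel n))}.
Proof.
move=> dim0 eps0; pose la := (3 * dim%:R + 2) / eps.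
have la0 : 0 < la by rewrite divr_gt0 // ltr_wpDl // mulr_ge0.
have [C [m1 [C0 HC]]] : exists C m0, 0 <= C /\ forall m, (m0 <= m)%N ->
    2 ^+ m * expR (lnn R m / 4) * tail_bound H (la^-1 * Num.sqrt (2 ^+ m / lnn R m))
        <= C.
  by apply: tail_bound_diffusive; rewrite ?invr_gt0.
have [m2 Hm2] := lnn_large (1 : R).
(* The variance term is at most z l / 2^q; the factor e is e^(tb) with t b = 1. *)
pose z := dim%:R * 2 ^+ dim * la ^+ 2 * (s2 / 2) * expR 1.
have z0 : 0 <= z.
  apply: mulr_ge0; last exact: expR_ge0.
  by rewrite !mulr_ge0 ?exprn_ge0 ?invr_ge0 // ltW.
pose q := Num.bound z.
have zq : z <= 2 ^+ q.
  rewrite ltW // (lt_le_trans (archi_boundP z0)) // -natrX ler_nat ltnW //.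
  exact: ltn_expl.
exists q, (4 * la)^-1; split; first by rewrite invr_gt0 mulr_gt0.
move=> e /andP[e0 ee0].
suff HA : forall m (n : mindex dim), (maxn m1 m2 <= m)%N -> mpos n -> mlevel n = m ->
    let p := mround (radix m) n in
    let A := [set w | eps * Num.sqrt (2 ^+ m * lnn R m) <=
      \sum_(i <- mslab (mround q p) p) Num.min (X i w) (cap e m)] in
    measurable A /\ (P A <= (expR (- (3 * dim%:R + 1) * lnn R m +
      dim%:R * 2 ^+ dim * C))%:E)%E.
  have := @ae_radix_level (fun m p _ => [set w | eps * Num.sqrt (2 ^+ m * lnn R m) <=
      \sum_(i <- mslab (mround q p) p) Num.min (X i w) (cap e m)]) _ _ dim0 HA.
  apply: filterS => w [M HM]; exists M => n Mn pn.
  exact: (@sum_ge_bound (fun a => Num.min a _) _ _ _ (HM n Mn pn)).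
move=> m n; rewrite geq_max => /andP[/HC{}HC /Hm2 l1] pn nm p A.
have pp : mpos p by exact: mpos_mround.
have pm : mlevel p = m by rewrite mlevel_mround.
set D := mslab (mround q p) p; have Du : uniq D by exact: mslab_uniq.
have Dp : all (@mpos dim) D by exact: mslab_pos.
split.
  by apply: (@measurable_sum_ge (fun a => Num.min a _)) => //; exact: measurable_minr.
have [_ pN] := msize_bounds pp; rewrite pm in pN.
set N : R := 2 ^+ m in HC pN *; set a : R := (size D)%:R.
have N0 : 0 < N by rewrite exprn_gt0.
have aN : 2 ^+ q * a <= dim%:R * 2 ^+ dim * N.
  have : 2 ^+ q * a <= dim%:R * (msize p)%:R.
    by rewrite -natrX -!natrM ler_nat; exact: size_mslab_mround.
  by move/le_trans; apply; rewrite -mulrA ler_wpM2l.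
have a0 : 0 <= a by exact: ler0n.
have aN' : a <= dim%:R * 2 ^+ dim * N.
  by apply: le_trans aN; rewrite ler_peMl // exprn_ege1 // ler1n.
have l0 : 0 < lnn R m by exact: lt_le_trans l1.
have [] := scaling_identities la eps e l0; rewrite -/N.
set t := la * _ => tx t2 ty tb.
have t0 : 0 <= t by rewrite mulr_ge0 ?sqrtr_ge0 // ltW.
set b := la^-1 * _ in HC tb.
have b0 : 0 < b by rewrite mulr_gt0 ?invr_gt0 // sqrtr_gt0 divr_gt0.
apply: (le_trans (truncated_sum_tail (cap e m) _ t0 b0 Du Dp)).
rewrite lee_fin ler_expR -/a tx tb ty t2 divff ?gt_eqF // mulrDr.
have tbd := tail_bound_ge0 b H0.
have h1 : a * (la ^+ 2 * (lnn R m / N) * s2 / 2 * expR 1) <= lnn R m.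
  have -> : a * (la ^+ 2 * (lnn R m / N) * s2 / 2 * expR 1) =
     (lnn R m / N) * ((la ^+ 2 * (s2 / 2) * expR 1) * a).
    by field; rewrite gt_eqF.
  have zE : (la ^+ 2 * (s2 / 2) * expR 1) * a <= N.
    have q0 : 0 < 2 ^+ q :> R by rewrite exprn_gt0.
    rewrite -(ler_pM2l q0) mulrCA.
    have w0 : 0 <= la ^+ 2 * (s2 / 2) * expR 1.
      apply: mulr_ge0; last exact: expR_ge0.
      by rewrite mulr_ge0 ?sqr_ge0 // divr_ge0.
    apply: le_trans (ler_wpM2l w0 aN) _.
    have -> : la ^+ 2 * (s2 / 2) * expR 1 * (dim%:R * 2 ^+ dim * N) = z * N.
      by rewrite /z; ring.
    by rewrite ler_wpM2r // ltW.
  have lN : 0 <= lnn R m / N by rewrite divr_ge0 // ltW.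
  apply: le_trans (ler_wpM2l lN zE) _.
  by rewrite divfK // gt_eqF.
have h2 : a * (expR (la * e * lnn R m) * tail_bound H b) <= dim%:R * 2 ^+ dim * C.
  apply: (@le_trans _ _ (dim%:R * 2 ^+ dim * N * (expR (lnn R m / 4) * tail_bound H
      b))).
    apply: ler_pM; [exact: a0 | by rewrite mulr_ge0 ?expR_ge0 | exact: aN' |].
    rewrite ler_wpM2r // ler_expR [leRHS]mulrC ler_wpM2r ?(ltW l0) //.
    apply: le_trans (ler_wpM2l (ltW la0) ee0) _.
    by rewrite invfM mulrCA divff ?mulr1 // gt_eqF.
  by rewrite -mulrA ler_wpM2l ?mulr_ge0 ?exprn_ge0 // mulrA.
have -> : la * eps = 3 * dim%:R + 2 by rewrite /la divfK // gt_eqF.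
by lra.
Qed.

Lemma size_cell_bound (D : seq (mindex dim)) (p : mindex dim) m : (0 < m)%N -> mpos p ->
  mlevel p = m -> (2 ^ radix m * size D <= dim * msize p)%N ->
  (size D)%:R * m%:R ^+ 2 <= 4 * dim%:R * 2 ^+ dim * 2 ^+ m :> R.
Proof.
move=> m0 pp pm hD; have [_] := msize_bounds pp; rewrite pm => pN.
apply: (@le_trans _ _ (4 * (dim%:R * (msize p)%:R))); last first.
  by rewrite -!mulrA ler_wpM2l // ler_wpM2l.
rewrite -natrX -!natrM ler_nat.
by have := radix_ge m; nia.
Qed.

(** The slab reaches up to [mceil] so that the event depends only on the key; the nonnegative terms
    allow this enlargement. There is no variance term: O(2^m / m^2) terms times their exceedance
    cost is O(1) by [tail_bound_subdiffusive]. *)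
Lemma ae_excess_bound (eps : R) : (0 < dim)%N -> 0 < eps ->
  exists2 e0, 0 < e0 & forall e, 0 < e <= e0 ->
  {ae P, forall w, exists M, forall n : mindex dim, (M <= mlevel n)%N -> mpos n ->
    let m := mlevel n in
    \sum_(i <- mslab (mround (radix m) n) (mceil (radix m) n))
      Num.min (Num.max (X i w - Num.sqrt (2 ^+ m) / m%:R) 0) (cap e m) <=
    eps * Num.sqrt (2 ^+ m * lnn R m)}.
Proof.
move=> dim0 eps0; pose la := (3 * dim%:R + 1) / eps.
have la0 : 0 < la by rewrite divr_gt0 // ltr_wpDl // mulr_ge0.
have [C [m1 [C0 HC]]] := tail_bound_subdiffusive H0.
have [m2 Hm2] := lnn_large (1 : R).
exists (4 * la)^-1; first by rewrite invr_gt0 mulr_gt0.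
move=> e /andP[e0 ee0].
pose B m p r := [set w | eps * Num.sqrt (2 ^+ m * lnn R m) <=
      \sum_(i <- mslab p r)
      Num.min (Num.max (X i w - Num.sqrt (2 ^+ m) / m%:R) 0) (cap e m)].
suff HA : forall m (n : mindex dim), (maxn 1 (maxn m1 m2) <= m)%N -> mpos n -> mlevel
    n = m ->
    let A := B m (mround (radix m) n) (mceil (radix m) n) in
    measurable A /\ (P A <= (expR (- (3 * dim%:R + 1) * lnn R m +
      4 * dim%:R * 2 ^+ dim * C))%:E)%E.
  have := @ae_radix_level B _ _ dim0 HA.
  apply: filterS => w [M HM]; exists M => n Mn pn.
  exact: (@sum_ge_bound (fun a => Num.min (Num.max (a - _) 0) _) _ _ _ (HM n Mn pn)).
move=> m n; rewrite !geq_max => /and3P[m0 /HC{}HC /Hm2 l1] pn nm A.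
set r := mceil (radix m) n; set D := mslab (mround (radix m) n) r.
have pr : mpos r by exact: mpos_mceil.
have rm : mlevel r = m by rewrite mlevel_mceil.
have Du : uniq D by exact: mslab_uniq.
have Dp : all (@mpos dim) D by exact: mslab_pos.
split.
  apply: (@measurable_sum_ge (fun a => Num.min (Num.max (a - _) 0) _)) => //.
  apply: measurable_minr => //; apply: measurable_maxr => //; exact: measurable_funB.
have aN := size_cell_bound m0 pr rm (size_mslab_mceil (radix m) pn).
rewrite -/D in aN; set N : R := 2 ^+ m in HC aN *; set a : R := (size D)%:R in aN *.
have N0 : 0 < N by rewrite exprn_gt0.
have mR : 0 < m%:R :> R by rewrite ltr0n.
have a0 : 0 <= a by exact: ler0n.
have l0 : 0 < lnn R m by exact: lt_le_trans l1.
have [] := scaling_identities la eps e l0; rewrite -/N.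
set t := la * _ => tx _ ty _.
have t0 : 0 <= t by rewrite mulr_ge0 ?sqrtr_ge0 // ltW.
set c := Num.sqrt N / m%:R in HC.
have c0 : 0 < c by rewrite divr_gt0 // sqrtr_gt0.
have y0 : 0 <= cap e m by exact/cap_ge0/ltW.
apply: (le_trans (excess_sum_tail _ t0 c0 y0 Du Dp)).
rewrite lee_fin ler_expR -/a tx ty.
have tbd := tail_bound_ge0 c H0.
have aN' : a <= 4 * dim%:R * 2 ^+ dim * (N / m%:R ^+ 2).
  by rewrite mulrA ler_pdivlMr ?exprn_gt0.
have h2 : a * (expR (la * e * lnn R m) * tail_bound H c) <= 4 * dim%:R * 2 ^+ dim * C.
  apply: (@le_trans _ _ (4 * dim%:R * 2 ^+ dim * (N / m%:R ^+ 2) *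
      (expR (lnn R m / 4) * tail_bound H c))).
    apply: ler_pM; [exact: a0 | by rewrite mulr_ge0 ?expR_ge0 | exact: aN' |].
    rewrite ler_wpM2r // ler_expR [leRHS]mulrC ler_wpM2r ?(ltW l0) //.
    apply: le_trans (ler_wpM2l (ltW la0) ee0) _.
    by rewrite invfM mulrCA divff ?mulr1 // gt_eqF.
  by rewrite -mulrA ler_wpM2l ?mulr_ge0 ?exprn_ge0 // mulrA.
have -> : la * eps = 3 * dim%:R + 1 by rewrite /la divfK // gt_eqF.
by lra.
Qed.

(** Truncation at c = sqrt(2^m) / m allows t of order 1/c. On O(2^m / m^2) terms the variance term
    is then O(1) while t x >= (2d + 2) m, and e^(-(2d+2)m) beats the number of all indices of level
    [m]. *)
Lemma ae_fine_bound (eps : R) : (0 < dim)%N -> 0 < eps ->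
  {ae P, forall w, exists M, forall n : mindex dim, (M <= mlevel n)%N -> mpos n ->
    let m := mlevel n in
    \sum_(i <- mslab (mround (radix m) n) n)
      Num.min (X i w) (Num.sqrt (2 ^+ m) / m%:R) <=
    eps * Num.sqrt (2 ^+ m * lnn R m)}.
Proof.
move=> dim0 eps0; pose la := (2 * dim%:R + 2) / eps.
have la0 : 0 < la by rewrite divr_gt0 // ltr_wpDl // mulr_ge0.
have [C [m1 [C0 HC]]] := tail_bound_subdiffusive H0.
have [m2 Hm2] := lnn_large (1 : R).
pose k : R := 4 * dim%:R * 2 ^+ dim.
have k0 : 0 <= k by rewrite !mulr_ge0 ?exprn_ge0.
pose C' := k * (la ^+ 2 * (s2 / 2) * expR la + expR la * C).
pose u m := expR (- (2 * dim%:R + 2) * m%:R + C') : R.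
pose B m p (_ : mindex dim) := [set w | eps * Num.sqrt (2 ^+ m * lnn R m) <=
      \sum_(i <- mslab (mround (radix m) p) p)
      Num.min (X i w) (Num.sqrt (2 ^+ m) / m%:R)].
suff HA : forall m (n : mindex dim), (maxn 1 (maxn m1 m2) <= m)%N -> mpos n -> mlevel
    n = m ->
    let A := B m (mround m n) (mceil m n) in
    measurable A /\ (P A <= (u m)%:E)%E.
  have : {ae P, forall w, exists M, forall n : mindex dim, (M <= mlevel n)%N -> mpos
      n ->
     ~ B (mlevel n) (mround (mlevel n) n) (mceil (mlevel n) n) w}.
    (* Keeping [m] digits on level [m] rounds nothing, so the keys enumerate the indices
       themselves. *)
    apply: (@ae_level id B u (2 ^+ dim.-1 * 3 ^+ dim * expR C') 1 _ _ _ _ _ HA).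
    - by rewrite !mulr_ge0 ?exprn_ge0 ?expR_ge0.
    - exact: ltr01.
    - by move=> m _; exact: expR_ge0.
    - move=> m; rewrite geq_max => /andP[m0 _]; rewrite /u expRD.
      have h1 := @card_factor_le R m dim.-1 m0.
      have h2 := @full_factor_le R m dim.
      rewrite mulrA; set b := expR C'; have b0 : 0 <= b by exact: expR_ge0.
      set G := expR (- (2 * dim%:R + 2) * m%:R); have G0 : 0 <= G by exact: expR_ge0.
      apply: (@le_trans _ _ ((2 ^+ dim.-1 * expR (dim.-1%:R * lnn R m)) *
        (3 ^+ dim * expR (dim%:R * m%:R)) * G * b)).
        by do 2 (apply: ler_wpM2r => //); apply: ler_pM.
      have -> : 2 ^+ dim.-1 * expR (dim.-1%:R * lnn R m) * (3 ^+ dim * expR (dim%:R *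
          m%:R)) * G * b
        = (2 ^+ dim.-1 * 3 ^+ dim * b) * (expR (dim.-1%:R * lnn R m) * expR (dim%:R *
            m%:R) * G).
        by ring.
      rewrite ler_wpM2l ?mulr_ge0 ?exprn_ge0 // /G -!expRD ler_expR.
      have lm := @lnn_le R m.
      have Dd : dim.-1%:R * lnn R m <= dim%:R * m%:R.
        apply: (@le_trans _ _ (dim.-1%:R * m%:R)); first by rewrite ler_wpM2l.
        by rewrite ler_wpM2r // ler_nat leq_pred.
      lra.
  apply: filterS => w [M HM]; exists M => n Mn pn.
  have := HM n Mn pn; rewrite mround_id //.
  exact: (@sum_ge_bound (fun a => Num.min a _)).
move=> m n; rewrite !geq_max => /and3P[m0 /HC{}HC /Hm2 l1] pn nm.
rewrite /= mround_id ?nm // /B.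
set D := mslab (mround (radix m) n) n.
have Du : uniq D by exact: mslab_uniq.
have Dp : all (@mpos dim) D by exact: mslab_pos.
split.
  by apply: (@measurable_sum_ge (fun a => Num.min a _)) => //; exact: measurable_minr.
have aN := size_cell_bound m0 pn nm (size_mslab_mround (radix m) pn).
rewrite -/D -/k in aN; set N : R := 2 ^+ m in HC aN *; set a : R := (size D)%:R in aN *.
have N0 : 0 < N by rewrite exprn_gt0.
have sN0 : 0 < Num.sqrt N by rewrite sqrtr_gt0.
have mR : 0 < m%:R :> R by rewrite ltr0n.
have a0 : 0 <= a by exact: ler0n.
have l0 : 0 < lnn R m by exact: lt_le_trans l1.
set c := Num.sqrt N / m%:R in HC *.
have c0 : 0 < c by rewrite divr_gt0.
pose t := la * m%:R / Num.sqrt N.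
have t0 : 0 <= t by rewrite ltW // divr_gt0 // mulr_gt0.
have tc : t * c = la by rewrite /t /c; field; rewrite !gt_eqF.
have t2 : t ^+ 2 = la ^+ 2 * (m%:R ^+ 2 / N).
  by rewrite /t expr_div_n exprMn sqr_sqrtr ?(ltW N0) // mulrA.
have tx : (2 * dim%:R + 2) * m%:R <= t * (eps * Num.sqrt (N * lnn R m)).
  rewrite sqrtrM ?(ltW N0) //.
  have -> : t * (eps * (Num.sqrt N * Num.sqrt (lnn R m))) =
     (la * eps) * m%:R * Num.sqrt (lnn R m) by rewrite /t; field; rewrite gt_eqF.
  rewrite {1}/la divfK ?gt_eqF // ler_peMr ?mulr_ge0 ?addr_ge0 ?mulr_ge0 //.
  by rewrite -sqrtr1 ler_sqrt // ltW.
apply: (le_trans (truncated_sum_tail c _ t0 c0 Du Dp)).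
rewrite lee_fin ler_expR -/a tc t2 mulrDr.
have tbd := tail_bound_ge0 c H0.
have h1 : a * (la ^+ 2 * (m%:R ^+ 2 / N) * s2 / 2 * expR la) <=
    k * (la ^+ 2 * (s2 / 2) * expR la).
  have -> : a * (la ^+ 2 * (m%:R ^+ 2 / N) * s2 / 2 * expR la) =
     (a * m%:R ^+ 2 / N) * (la ^+ 2 * (s2 / 2) * expR la).
    by field; rewrite gt_eqF.
  rewrite ler_wpM2r //; last by rewrite ler_pdivrMr.
  apply: mulr_ge0; last exact: expR_ge0.
  by rewrite mulr_ge0 ?sqr_ge0 // divr_ge0.
have h2 : a * (expR la * tail_bound H c) <= k * (expR la * C).
  have aN' : a <= k * (N / m%:R ^+ 2) by rewrite mulrA ler_pdivlMr ?exprn_gt0.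
  have Nm0 : 0 <= N / m%:R ^+ 2 by rewrite divr_ge0 ?sqr_ge0 // ltW.
  have HC' : N / m%:R ^+ 2 * tail_bound H c <= C.
    apply: le_trans HC; rewrite ler_wpM2r // ler_peMr //.
    by rewrite -expR0 ler_expR divr_ge0 // ltW.
  apply: (@le_trans _ _ (k * (N / m%:R ^+ 2) * (expR la * tail_bound H c))).
    by rewrite ler_wpM2r // mulr_ge0 ?expR_ge0.
  have -> : k * (N / m%:R ^+ 2) * (expR la * tail_bound H c) =
     k * (expR la * (N / m%:R ^+ 2 * tail_bound H c)) by ring.
  by rewrite !ler_wpM2l // expR_ge0.
rewrite /C' mulrDr; lra.
Qed.

(** All levels up to [m] are treated at once, because the box of an index of level [m] contains
    indices of every lower level. *)
Lemma ae_term_bound (e M : R) : 0 < e ->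
  (\int[P]_w (moment_weight dim.-1 (Y w))%:E <= M%:E)%E ->
  {ae P, forall w, exists m0, forall m, (m0 <= m)%N ->
    forall n : mindex dim, mpos n -> (mlevel n <= m)%N -> X n w <= cap e m}.
Proof.
move=> e0 HM.
have [B [m0 HB]] := sum_level_exceedance_le mY dim e0 HM.
pose E m := [set w | exists n : mindex dim, [/\ mpos n, (mlevel n <= m)%N & cap e m <
    X n w]].
have : {ae P, forall w, exists M0 : nat, forall m, (M0 <= m)%N -> ~ E m w}.
  apply: (@borel_cantelli_eventually _ T R P E _ B m0) HB => m m0m.
  set u := fine _.
  have u0 : 0 <= u by exact: fine_ge0.
  (* A positive index of level at most [m] has all coordinates below 2^(m+1), so this finite type
     contains them all. *)
  pose K := {f : {ffun 'I_dim -> 'I_(2 ^ m.+1).+1} | (mlevel (mval f) <= m)%N}.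
  have [F [mF EF PF]] : exists F, [/\ measurable F,
      forall f : K, mpos (mval (val f)) -> [set w | cap e m < X (mval (val f)) w]
          `<=` F &
      (P F <= (#|{: K}|%:R * u)%:E)%E].
    apply: (@finite_union_bound _ T R P K K id) => //.
    - by move=> f g _ _ ->.
    - move=> f pf; have mXf := mX pf; split; first exact: measurable_gt_preimage.
      have -> : [set w | cap e m < X (mval (val f)) w] =
          X (mval (val f)) @^-1` `]cap e m, +oo[%classic.
        by apply/seteqP; split => w /=; rewrite in_itv /= andbT.
      rewrite idX // /u fineK ?fin_num_measure //; last exact: measurable_gt_preimage.
      rewrite le_eqVlt; apply/orP; left; apply/eqP; congr (P _).
      by apply/seteqP; split => w /=; rewrite in_itv /= andbT.
  exists F; split => //.
    move=> w [n [pn nm xn]].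
    have ltn i : (n i < (2 ^ m.+1).+1)%N.
      rewrite ltnS ltnW // (leq_trans (trunc_log_ltn _ (isT : (1 < 2)%N))) //.
      by rewrite leq_exp2l // ltnS (leq_trans (mlevel_ge n i)).
    have nE : mval [ffun i => Ordinal (ltn i)] = n.
      by apply/ffunP => i; rewrite !ffunE.
    have lf : (mlevel (mval [ffun i => Ordinal (ltn i)]) <= m)%N by rewrite nE.
    have := EF (exist (fun f => is_true (mlevel (mval f) <= m)%N) _ lf).
    by rewrite /= nE; apply.
  apply: (le_trans PF); rewrite lee_fin ler_wpM2r // ler_nat.
  rewrite card_sig; exact: card_level_le.
apply: filterS => w [M0 HM0]; exists M0 => m Mm n pn nm.
rewrite leNgt; apply/negP => xn; apply: (HM0 m Mm).
by exists n.
Qed.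
End level_events.

(** * The upper bound *)

Section assembly.
Context d (T : measurableType d) (R : realType) (P : probability T R).
Variable dim : nat.
Hypothesis dim2 : (2 <= dim)%N.

Let dim0 : (0 < dim)%N. Proof. exact: leq_trans dim2. Qed.

Lemma SsumE (X : mindex dim -> T -> R) n w : Ssum X n w = \sum_(i <- mbox n) X i w.
Proof. by rewrite /Ssum /mbox big_map big_enum. Qed.

Lemma sum_mbox_split (f : mindex dim -> R) p n : mle p n ->
  \sum_(i <- mbox n) f i = \sum_(i <- mbox p) f i + \sum_(i <- mslab p n) f i.
Proof. by move=> pn; rewrite (perm_big _ (perm_mbox_mslab pn)) big_cat. Qed.

Lemma ler_sum_mslab (f : mindex dim -> R) p n n' : (forall i, 0 <= f i) -> mle n n' ->
  \sum_(i <- mslab p n) f i <= \sum_(i <- mslab p n') f i.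
Proof.
move=> f0 nn.
have pe : perm_eq (mslab p n') (mslab p n ++ [seq i <- mslab p n' | i \notin mslab p
    n]).
  apply: uniq_perm; first exact: mslab_uniq.
    rewrite cat_uniq mslab_uniq filter_uniq ?mslab_uniq // andbT /=.
    by apply/hasPn => i; rewrite mem_filter => /andP[].
  move=> i; rewrite mem_cat mem_filter; case: (boolP (i \in mslab p n)) => //= h.
  exact: (mslab_subset nn).
rewrite (perm_big _ pe) big_cat /= lerDl sumr_ge0 //.
Qed.

Section one_sided.
Variable X : mindex dim -> T -> R.
Hypothesis mX : forall n, mpos n -> measurable_fun setT (X n).
Hypothesis naX : neg_assoc P (fun n => mpos n) X.
Hypothesis idX : forall n, mpos n -> forall B : set R, measurable B ->
  P (X n @^-1` B) = P (X (mone dim) @^-1` B).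
Variables s2 M : R.
Hypothesis iY : P.-integrable setT (EFin \o X (mone dim)).
Hypothesis EY : (\int[P]_w (X (mone dim) w)%:E = 0)%E.
Hypothesis EY2 : (\int[P]_w (X (mone dim) w ^+ 2)%:E <= s2%:E)%E.
Hypothesis HM : (\int[P]_w (moment_weight dim.-1 (X (mone dim) w))%:E <= M%:E)%E.

(** The box of [n] is cut at p <= r <= n. Eventually no term exceeds the cap, so truncation there is
    free; the slab from r to n is further split as X = min(X, c) + (X - c)^+. The three error terms
    cost [eps] each. *)
Lemma ae_upper_bound (s eps : R) : 0 < s -> s2 < s ^+ 2 -> 0 < eps ->
  {ae P, forall w, exists m0, forall n : mindex dim, (m0 <= mlevel n)%N -> mpos n ->
    \sum_(i <- mbox n) X i w <=
      s * Num.sqrt (2 * dim%:R * (msize n)%:R * lnn R (mlevel n)) +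
      3 * eps * Num.sqrt (2 ^+ mlevel n * lnn R (mlevel n))}.
Proof.
move=> s0 s2s eps0.
have s20 : 0 <= s2.
  rewrite -lee_fin (le_trans _ EY2) // integral_ge0 // => w _.
  by rewrite lee_fin sqr_ge0.
have HH : (\int[P]_w (X (mone dim) w ^+ 2 * Num.sqrt (Log `|X (mone dim) w|))%:E <=
    (2 * M)%:E)%E.
  apply: moment_sqrt_le HM; last by rewrite -ltnS prednK.
  by apply: mX; exact: mpos_mone.
have H0 : 0 <= 2 * M.
  rewrite -lee_fin (le_trans _ HH) // integral_ge0 // => w _.
  by rewrite lee_fin mulr_ge0 ?sqr_ge0 ?sqrtr_ge0.
have [q [e1 [e10 h1]]] := ae_increment_bound mX naX idX s20 H0 iY EY EY2 HH dim0 eps0.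
have [e2 e20 h2] := ae_grid_bound mX naX idX s20 H0 iY EY EY2 HH q dim0 s0 s2s.
have [e3 e30 h3] := ae_excess_bound mX naX idX s20 H0 iY EY2 HH dim0 eps0.
have h4 := ae_fine_bound mX naX idX s20 H0 iY EY EY2 HH dim0 eps0.
pose e := Num.min e1 (Num.min e2 e3).
have e0 : 0 < e by rewrite !lt_min e10 e20.
have /h1{}h1 : 0 < e <= e1 by rewrite e0 ge_min lexx.
have /h2{}h2 : 0 < e <= e2 by rewrite e0 !ge_min lexx orbT.
have /h3{}h3 : 0 < e <= e3 by rewrite e0 !ge_min lexx !orbT.
have h5 := ae_term_bound mX idX e0 HM.
have := ae_and h1 (ae_and h2 (ae_and h3 (ae_and h4 h5))).
apply: filterS => w [[M1 {}h1] [[M2 {}h2] [[M3 {}h3] [[M4 {}h4] [M5 {}h5]]]]].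
exists (maxn M1 (maxn M2 (maxn M3 (maxn M4 M5)))) => n.
rewrite !geq_max => /and5P[n1 n2 n3 n4 n5] pn.
set m := mlevel n in n1 n2 n3 n4 n5 *.
pose r := mround (radix m) n; pose p := mround q r.
have pr : mpos r by exact: mpos_mround.
have rm : mlevel r = m by rewrite mlevel_mround.
have rn : mle r n by exact: mround_le.
have pler : mle p r by exact: mround_le.
have y0 : 0 <= cap e m by exact/cap_ge0/ltW.
have Xy i : i \in mbox n -> X i w <= cap e m.
  rewrite mem_mbox => /andP[pi ile]; apply: h5 => //; exact: mlevel_le.
have Xmin k : mle k n -> \sum_(i <- mbox k) X i w = \sum_(i <- mbox k) Num.min (X i
    w) (cap e m).
  move=> kn; rewrite big_seq [RHS]big_seq; apply: eq_bigr => i ik.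
  rewrite (min_idPl _) // Xy //; move: ik; rewrite !mem_mbox => /andP[-> ik].
  exact: mle_trans ik kn.
(* The grid bound is used at [r], which has the level of [n], so that the grid point is [p]. *)
have := h2 r; rewrite rm -/p => /(_ n2 pr) g1.
have := h1 n n1 pn; rewrite -/m -/r -/p => g2.
have := h3 n n3 pn; rewrite /= -/m -/r; set c := Num.sqrt _ / _ => g3.
have := h4 n n4 pn; rewrite /= -/m -/r -/c => g4.
have c0 : 0 <= c by rewrite divr_ge0 ?sqrtr_ge0.
rewrite (sum_mbox_split _ rn) (sum_mbox_split _ pler) (Xmin p (mle_trans pler rn)).
have -> : \sum_(i <- mslab p r) X i w = \sum_(i <- mslab p r) Num.min (X i w) (cap e m).
  rewrite big_seq [RHS]big_seq; apply: eq_bigr => i.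
  rewrite mem_filter mem_mbox => /and3P[_ pi ir].
  by rewrite (min_idPl _) // Xy // mem_mbox pi (mle_trans ir rn).
have k3 : \sum_(i <- mslab r n) X i w <=
   \sum_(i <- mslab r n) Num.min (X i w) c +
   \sum_(i <- mslab r (mceil (radix m) n)) Num.min (Num.max (X i w - c) 0) (cap e m).
  apply: (@le_trans _ _ (\sum_(i <- mslab r n) Num.min (X i w) c +
     \sum_(i <- mslab r n) Num.min (Num.max (X i w - c) 0) (cap e m))).
    rewrite -big_split /= big_seq [leRHS]big_seq; apply: ler_sum => i.
    rewrite mem_filter => /andP[_ /Xy xy].
    case: (leP (X i w) c) => xc.
      by rewrite lerDl le_min y0 le_max lexx orbT.
    have xc0 : 0 <= X i w - c by rewrite subr_ge0 ltW.
    have xy' : X i w - c <= cap e m by lra.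
    by rewrite (max_idPl xc0) (min_idPl xy') addrC subrK.
  rewrite lerD2l; apply: ler_sum_mslab; last exact: mceil_ge.
  by move=> i; rewrite le_min y0 le_max lexx orbT.
have pn' : (msize p <= msize n)%N.
  rewrite /msize; apply: leq_prod => i _.
  by have /forallP := mle_trans pler rn; apply.
have g1' : s * Num.sqrt (2 * dim%:R * (msize p)%:R * lnn R m) <=
    s * Num.sqrt (2 * dim%:R * (msize n)%:R * lnn R m).
  rewrite ler_wpM2l ?(ltW s0) //.
  case: (leP 0 (lnn R m)) => l0.
    by rewrite ler_sqrt ?mulr_ge0 // ler_wpM2r // ler_wpM2l ?mulr_ge0 // ler_nat.
  (* [Num.sqrt] is 0 on negative numbers. *)
  rewrite ler0_sqrtr ?sqrtr_ge0 //.
  by rewrite mulr_ge0_le0 ?mulr_ge0 // ltW.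
lra.
Qed.
End one_sided.

(** The functions -f(-x) and -g(-x) are again nondecreasing, and two sign changes leave the
    covariance unchanged. *)
Lemma neg_assocN (X : mindex dim -> T -> R) (J : set (mindex dim)) :
  neg_assoc P J X -> neg_assoc P J (fun n w => - X n w).
Proof.
move=> naX m p A B f g uA uB JA JB AB fnd gnd F G iF iG iFG.
have := naX m p A B (fun x => - f [ffun j => - x j]) (fun x => - g [ffun j => - x j])
  uA uB JA JB AB.
have nd (k : nat) (h : {ffun 'I_k -> R} -> R) :
    (forall x y : {ffun 'I_k -> R}, (forall j, x j <= y j) -> h x <= h y) ->
    forall x y : {ffun 'I_k -> R}, (forall j, x j <= y j) ->
    - h [ffun j => - x j] <= - h [ffun j => - y j].
  by move=> hnd x y xy; rewrite lerN2; apply: hnd => j; rewrite !ffunE lerN2.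
move=> /(_ (nd _ _ fnd) (nd _ _ gnd)) /=.
have eF (k : nat) (C : k.-tuple (mindex dim)) (h : {ffun 'I_k -> R} -> R) w :
    h [ffun j => - [ffun j0 => X (tnth C j0) w] j] = h [ffun j => - X (tnth C j) w].
  by congr h; apply/ffunP => j; rewrite !ffunE.
have -> : (fun w => - f [ffun j => - [ffun j0 => X (tnth A j0) w] j]) = (fun w => - F
    w).
  by apply/funext => w; rewrite eF.
have -> : (fun w => - g [ffun j => - [ffun j0 => X (tnth B j0) w] j]) = (fun w => - G
    w).
  by apply/funext => w; rewrite eF.
have iN (h : T -> R) : P.-integrable setT (EFin \o h) ->
    P.-integrable setT (EFin \o (fun w => - h w)).
  move=> ih; rewrite (_ : _ \o _ = (\- (EFin \o h))%E) //.
  exact: integrableN.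
have -> : (fun w => - F w) \* (fun w => - G w) = F \* G.
  by apply/funext => w /=; rewrite mulrNN.
move=> /(_ (iN _ iF) (iN _ iG) iFG).
have EN (h : T -> R) : P.-integrable setT (EFin \o h) -> ('E_P[fun w => (- h w)%R] =
    - 'E_P[h])%E.
  move=> ih; rewrite expectation.unlock.
  under eq_integral do rewrite EFinN.
  by rewrite (integralN _) //; exact: integrable_add_def.
by rewrite (EN _ iF) (EN _ iG) muleNN.
Qed.

End assembly.

(** Log (Log (2^m)) is at least ln m + ln (ln 2), and the constant is absorbed by a small multiple
    of ln m. *)
Lemma lnn_le_LogLog (R : realType) (h : R) : 0 < h ->
  exists m0, forall m, (m0 <= m)%N ->
    lnn R m <= (1 + h) * Log (Log (2 ^+ m)).
Proof.
move=> h0; have ln20 := @ln2_gt0 R.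
pose c : R := - ln (ln 2).
have [m1 Hm1] := lnn_large (c / h + c).
exists (maxn 1 m1) => m; rewrite geq_max => /andP[m0 /Hm1 hl].
have mR : 0 < m%:R :> R by rewrite ltr0n.
have LL : lnn R m - c <= Log (Log (2 ^+ m)).
  have h1 : ln 2 * m%:R <= Log (2 ^+ m) :> R.
    by rewrite exp2nE -[leLHS]expRK Log_ge_ln ?expR_gt0.
  apply: le_trans (ler_Log h1).
  apply: le_trans (Log_ge_ln _); last by rewrite mulr_gt0.
  by rewrite lnM ?posrE // /c /lnn opprK addrC.
apply: (@le_trans _ _ ((1 + h) * (lnn R m - c))); last first.
  by rewrite ler_wpM2l // addr_ge0 // ltW.
have hl' : c <= (lnn R m - c) * h by rewrite -ler_pdivrMr // lerBrDr.
lra.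
Qed.

Theorem theorem1p2 (d : measure_display) (T : measurableType d) (R : realType)
  (P : probability T R) (dim : nat) (X : mindex dim -> T -> R) :
  (2 <= dim)%N ->
  (forall n, mpos n -> measurable_fun setT (X n)) ->
  neg_assoc P (fun n => mpos n) X ->
  (forall n, mpos n -> forall B : set R, measurable B ->
     P (X n @^-1` B) = P (X (mone dim) @^-1` B)) ->
  P.-integrable setT (EFin \o X (mone dim)) ->
  ('E_P[X (mone dim)] = 0)%E ->
  ('E_P[fun w => (X (mone dim) w ^+ 2 * Log `|X (mone dim) w| ^+ (dim.-1)
                   / Log (Log `|X (mone dim) w|))%R] < +oo)%E ->
  {ae P, forall w,
     (mlimsup (fun n => (`|Ssum X n w| /
        Num.sqrt (2 * dim%:R * (msize n)%:R * Log (Log (msize n)%:R)))%R)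
      <= (Num.sqrt (fine 'E_P[fun v => (X (mone dim) v ^+ 2)%R]))%:E)%E}.
Proof.
move=> dim2 mX naX idX iY; rewrite expectation.unlock => EY EPhi.
have dim0 : (0 < dim)%N by exact: leq_trans dim2.
set Y := X (mone dim) in iY EY EPhi *.
have mY : measurable_fun setT Y by apply: mX; exact: mpos_mone.
have Phi0 : (0 <= \int[P]_w (moment_weight dim.-1 (Y w))%:E)%E.
  by apply: integral_ge0 => w _; rewrite lee_fin moment_weight_ge0.
pose M := fine (\int[P]_w (moment_weight dim.-1 (Y w))%:E).
have HM : (\int[P]_w (moment_weight dim.-1 (Y w))%:E <= M%:E)%E.
  by rewrite /M fineK // ge0_fin_numE.
(* Finiteness matters because [fine] would send an infinite second moment to 0. *)
have EY2lt : (\int[P]_w (Y w ^+ 2)%:E < +oo)%E.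
  apply: le_lt_trans (ltry (2 * M)); apply: le_trans (moment_sqrt_le mY _ HM); last
      by rewrite -ltnS prednK.
  apply: (@ge0_le_integral _ _ _ P _ measurableT).
  - by move=> w _; rewrite lee_fin sqr_ge0.
  - by apply/measurable_EFinP; exact: measurable_funX.
  - apply/measurable_EFinP; apply: measurable_funM; first exact: measurable_funX.
    apply: (measurableT_comp (@measurable_sqrtr R)).
    apply: (measurableT_comp (@measurable_Log R)).
    exact: measurableT_comp (@normr_measurable R setT) mY.
  - move=> w _; rewrite lee_fin ler_peMr ?sqr_ge0 //.
    by rewrite -sqrtr1 ler_sqrt ?Log_ge1 // ltW // Log_gt0.
set s2 := fine _.
have EY2 : (\int[P]_w (Y w ^+ 2)%:E <= s2%:E)%E.
  rewrite /s2 fineK // ge0_fin_numE // integral_ge0 // => w _.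
  by rewrite lee_fin sqr_ge0.
have s20 : 0 <= s2.
  by rewrite -lee_fin (le_trans _ EY2) // integral_ge0 // => w _; rewrite lee_fin
      sqr_ge0.
set sg := Num.sqrt s2; have sg0 : 0 <= sg by exact: sqrtr_ge0.
(* Slack along a sequence tending to 0, so that countably many almost sure events are
   intersected. *)
pose h (k : nat) : R := k.+1%:R^-1.
have h0 k : 0 < h k by rewrite invr_gt0 ltr0n.
pose B k (Z : mindex dim -> T -> R) w := exists m0, forall n : mindex dim,
  (m0 <= mlevel n)%N -> mpos n ->
    \sum_(i <- mbox n) Z i w <=
      (sg + h k) * Num.sqrt (2 * dim%:R * (msize n)%:R * lnn R (mlevel n)) +
      3 * h k * Num.sqrt (2 ^+ mlevel n * lnn R (mlevel n)).
have sk k : s2 < (sg + h k) ^+ 2.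
  rewrite -[ltLHS]sqr_sqrtr // -/sg ltr_sqr ?nnegrE ?addr_ge0 // ?(ltW (h0 k)) //.
  by rewrite ltrDl.
have sk0 k : 0 < sg + h k by rewrite ltr_wpDl.
have HU : {ae P, forall w, forall k, B k X w}.
  apply: ae_forall_nat => k.
  exact: (ae_upper_bound dim2 mX naX idX iY EY EY2 HM (sk0 k) (sk k) (h0 k)).
pose X' n w := - X n w.
have HL : {ae P, forall w, forall k, B k X' w}.
  apply: ae_forall_nat => k.
  apply: (@ae_upper_bound _ T R P dim dim2 X' _ _ _ s2 M _ _ _ _ (sg + h k) (h k)) =>
      //.
  - by move=> n pn; apply: measurable_funN; exact: mX.
  - exact: neg_assocN.
  - move=> n pn A mA.
    have E k' : X' k' @^-1` A = X k' @^-1` ((fun x : R => - x) @^-1` A) by [].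
    rewrite !E; apply: idX => //.
    rewrite -[X in measurable X]setTI.
    exact: (@oppr_measurable R setT measurableT A mA).
  - rewrite (_ : _ \o _ = (\- (EFin \o Y))%E) //; exact: integrableN.
  - under eq_integral do rewrite EFinN.
    by rewrite integralN ?EY ?oppe0 //; exact: integrable_add_def.
  - by under eq_integral do rewrite sqrrN.
  - by under eq_integral do rewrite /moment_weight sqrrN normrN.
have := ae_and HU HL.
apply: filterS => w [{}HU {}HL].
apply/lee_addgt0Pr => e e0; rewrite -EFinD.
(* The final bound is (sg + 4h)(1 + h), at most sg + (8 + sg) h when h <= 1. *)
have [k hk] : exists k, (8 + sg) * h k <= e.
  have z0 : 0 <= (8 + sg) / e by rewrite divr_ge0 ?addr_ge0 // ltW.
  exists (Num.bound ((8 + sg) / e)); rewrite /h ler_pdivrMr ?ltr0n //.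
  rewrite mulrC -ler_pdivrMr // ltW // (lt_le_trans (archi_boundP z0)) //.
  by rewrite ler_nat.
have hk1 : h k <= 1 by rewrite /h invf_le1 ?ltr0n // ler1n.
have [m1 Hm1] := HU k; have [m2 Hm2] := HL k.
have [m3 Hm3] := lnn_le_LogLog (h0 k).
(* The upper limit is an infimum over thresholds, so one suffices; a single coordinate above it
   already makes the level large enough. *)
pose N := (2 ^ maxn m1 (maxn m2 m3))%N.
apply: ge_ereal_inf.
exists (ereal_sup [set (`|Ssum X n w| /
    Num.sqrt (2 * dim%:R * (msize n)%:R * Log (Log (msize n)%:R)))%:E |
    n in [set n : mindex dim | forall i, (N <= n i)%N]]); first by exists N.
apply: ge_ereal_sup => _ [n /= Nn <-]; rewrite lee_fin.
have pn : mpos n by apply/forallP => i; rewrite (leq_trans _ (Nn i)) // expn_gt0.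
have : (maxn m1 (maxn m2 m3) <= mlevel n)%N.
  apply: leq_trans (mlevel_ge n (Ordinal dim0)).
  by apply: trunc_log_max.
rewrite !geq_max => /and3P[n1 n2 n3].
have {Hm1}b1 := Hm1 n n1 pn; have {Hm2}b2 := Hm2 n n2 pn; have {Hm3}b3 := Hm3 _ n3.
have [Nn1 _] := msize_bounds R pn.
set m := mlevel n in b1 b2 b3 Nn1.
set a : R := (msize n)%:R in b1 b2 Nn1 *.
have a0 : 0 < a by apply: lt_le_trans Nn1; rewrite exprn_gt0.
set LL := Log (Log a).
have LL0 : 0 < LL by exact: Log_gt0.
have lLL : lnn R m <= (1 + h k) * LL.
  apply: (le_trans b3); rewrite ler_wpM2l ?addr_ge0 ?(ltW (h0 k)) //.
  by do 2 apply: ler_Log.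
have dR : 1 <= dim%:R :> R by rewrite ler1n.
set Q := Num.sqrt (2 * dim%:R * a * LL).
have da0 : 0 < 2 * dim%:R * a by rewrite !mulr_gt0 // (lt_le_trans _ dR).
have Q0 : 0 < Q by rewrite sqrtr_gt0 mulr_gt0.
have hk0 := h0 k; have h10 : 0 <= 1 + h k by rewrite addr_ge0 // ltW.
(* Replacing ln m by Log (Log |n|) costs sqrt(1 + h) <= 1 + h. *)
have q1 : Num.sqrt (2 * dim%:R * a * lnn R m) <= (1 + h k) * Q.
  have -> : (1 + h k) * Q = Num.sqrt ((1 + h k) ^+ 2 * (2 * dim%:R * a * LL)).
    by rewrite sqrtrM ?sqr_ge0 // sqrtr_sqr ger0_norm // addr_ge0 // ltW.
  rewrite ler_sqrt ?mulr_ge0 ?sqr_ge0 ?(ltW a0) ?(ltW LL0) //.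
  have -> : (1 + h k) ^+ 2 * (2 * dim%:R * a * LL) =
      (2 * dim%:R * a) * ((1 + h k) * ((1 + h k) * LL)) by ring.
  rewrite ler_wpM2l ?(ltW da0) // (le_trans lLL) // ler_peMl ?mulr_ge0 ?(ltW LL0) //.
  by rewrite lerDl ltW.
have q2 : Num.sqrt (2 ^+ m * lnn R m) <= Num.sqrt (2 * dim%:R * a * lnn R m).
  case: (leP 0 (lnn R m)) => l0.
    rewrite ler_sqrt ?mulr_ge0 ?(ltW a0) // ler_wpM2r // (le_trans Nn1) //.
    by rewrite ler_peMl ?(ltW a0) //; lra.
  by rewrite ler0_sqrtr ?sqrtr_ge0 // mulr_ge0_le0 ?exprn_ge0 // ltW.
have S1 : `|Ssum X n w| <= (sg + h k + 3 * h k) * Num.sqrt (2 * dim%:R * a * lnn R m).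
  have q3 := ler_wpM2l (mulr_ge0 (ler0n R 3) (ltW hk0)) q2.
  rewrite SsumE ler_norml; apply/andP; split; last by lra.
  by move: b2; rewrite /X' sumrN; lra.
rewrite ler_pdivrMr //; apply: (le_trans S1).
apply: (@le_trans _ _ ((sg + h k + 3 * h k) * ((1 + h k) * Q))).
  by rewrite ler_wpM2l // !addr_ge0 ?mulr_ge0 ?(ltW hk0).
rewrite mulrA ler_wpM2r ?(ltW Q0) //.
have : h k ^+ 2 <= h k by rewrite expr2 ler_piMr // ltW.
rewrite -/sg; nra.
Qed.
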